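(* Let $a,b\ge2$ be integers, and let $I\subset P=\mathbb Z[x_0,\dots,x_a,y_0,\dots,y_b]$ be the ideal generated by the $2\times2$ minors of $\begin{pmatrix} x_0&\cdots&x_{a-1} \\ x_1&\cdots&x_a\end{pmatrix}$, the $2\times2$ minors of $\begin{pmatrix} y_0&\cdots&y_{b-1} \\ y_1&\cdots&y_b\end{pmatrix}$, and the forms $x_{i+2}y_j-2x_{i+1}y_{j+1}+x_iy_{j+2}$ for $0\le i\le a-2$, $0\le j\le b-2$ (the ideal defining the K3 carpet $X^{\mathbb Z}(a,b)$). Let $\operatorname{in}(I)$ be the initial ideal of $I$ with respect to the graded reverse lexicographic order with $x_0>\cdots>x_a>y_0>\cdots>y_b$. Then the Schreyer resolution of $\operatorname{in}(I)$ is minimal.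
   Context: A graded free resolution over $P$ is minimal if all entries of its differentials lie in the ideal $(x_0,\dots,x_a,y_0,\dots,y_b)$. Schreyer resolution: let $f_1,\dots,f_n$ be a normalized homogeneous Gröbner basis of an ideal (for a monomial ideal: its minimal monomial generators), sorted first by degree and then, within a degree, decreasingly in the reverse lexicographic order of the initial terms. Put $F_0=P$, $F_1=\bigoplus Pe_i$ with $e_i\mapsto f_i$. For $i=2,\dots,n$ let $M_i=(\operatorname{in}(f_1),\dots,\operatorname{in}(f_{i-1})):\operatorname{in}(f_i)$. Each minimal monomial generator $m$ of $M_i$ determines, by dividing $mf_i$ by the Gröbner basis with remainder zero, a syzygy with lead term $me_i$ with respect to the induced monomial order on $F_1$ ($m e_i>m'e_j$ if $m\operatorname{in}(f_i)>m'\operatorname{in}(f_j)$, or if these are equal up to a scalar and $i>j$). These syzygies form a Gröbner basis of the syzygy module, and $F_2$ is the free module with one basis element for each of them. One iterates: at each step the Gröbner basis elements whose lead terms involve the same basis element $e_k$ of the previous free module are sorted by degree and then decreasingly in reverse lexicographic order of the monomial coefficients $m_1,m_2,\dots$ of their lead terms, and the minimal monomial generators of the colon ideals $(m_1,\dots,m_{j-1}):m_j$ give the next syzygies. The resulting finite free resolution is the Schreyer resolution; for a monomial ideal it is multigraded. *)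

(* Defs.v *)
From mathcomp Require Import all_boot all_order all_algebra.
From mathcomp Require Import mpoly.

Set Implicit Arguments.
Unset Strict Implicit.
Unset Printing Implicit Defensive.

Import GRing.Theory.
Local Open Scope ring_scope.

Definition ideal_gen (R : comNzRingType) (S : R -> Prop) (f : R) : Prop :=
  exists s : seq (R * R),
    (forall p, p \in s -> S p.2) /\ f = \sum_(p <- s) p.1 * p.2.

Definition colon (R : comNzRingType) (J : R -> Prop) (g : R) : R -> Prop :=
  fun f => J (f * g).

(* The order on ['X_{1..n}] provided by mpoly.v compares exponent vectors
   lexicographically from the first variable within a degree; it is not the
   reverse lexicographic order, which is therefore defined here, with
   ['X_0 > 'X_1 > ...]. *)
Definition grevlex n (m1 m2 : 'X_{1..n}) : bool :=
  (mdeg m1 < mdeg m2)%N ||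
  (mdeg m1 == mdeg m2) &&
  [exists i : 'I_n, (m2 i < m1 i)%N &&
     [forall j : 'I_n, (i < j)%N ==> (m1 j == m2 j)]].

Definition is_lead n (f : {mpoly int[n]}) (m : 'X_{1..n}) : Prop :=
  m \in msupp f /\
  forall m', m' \in msupp f -> m' = m \/ grevlex m' m.

(* Initial terms keep their coefficients, since the base ring is [int]. *)
Definition initial_ideal n (I : {mpoly int[n]} -> Prop) :
    {mpoly int[n]} -> Prop :=
  ideal_gen (fun t => exists f m, [/\ I f, is_lead f m & t = f@_m *: 'X_[m]]).

Definition monomial_ideal n (ms : seq 'X_{1..n}) : {mpoly int[n]} -> Prop :=
  ideal_gen (fun g => exists2 m, m \in ms & g = 'X_[m]).

(* By degree, then decreasingly in the reverse lexicographic order. *)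
Definition schreyer_lt n (m1 m2 : 'X_{1..n}) : bool :=
  (mdeg m1 < mdeg m2)%N || (mdeg m1 == mdeg m2) && grevlex m2 m1.

Definition is_mingens n (J : {mpoly int[n]} -> Prop) (ms : seq 'X_{1..n}) :
    Prop :=
  [/\ forall f, J f <-> monomial_ideal ms f,
      {in ms &, forall m m', (m <= m')%MM -> m = m'}
    & sorted (@schreyer_lt n) ms].

Section Frame.

(* [gens 0 0] is meant to be the sorted list of minimal generators of the
   monomial ideal to be resolved, and [gens k.+1 i] that of the colon ideal
   attached to the [i]-th basis element of [F_(k+1)].  The [i]-th entry [(m, j)]
   of [frame k.+1] says that the [i]-th basis element of [F_(k+1)] is mapped to
   an element of [F_k] with lead term [m e_j]; [frame 0] stands for [F_0 = P],
   and its single entry carries no information. *)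
Variables (n : nat) (gens : nat -> nat -> seq 'X_{1..n}).

Fixpoint frame (k : nat) : seq ('X_{1..n} * nat) :=
  if k is k'.+1 then
    [seq (m, j) | j <- iota 0 (size (frame k')), m <- gens k' j]
  else [:: (0%MM, 0%N)].

Definition lead (k i : nat) : 'X_{1..n} * nat := nth (0%MM, 0%N) (frame k) i.

(* The ideal [M_i = (m_l : l < i) : m_i], where [l] ranges over the basis
   elements whose lead term involves the same basis element of the previous
   module as that of [i]. *)
Definition colon_ideal (k i : nat) : {mpoly int[n]} -> Prop :=
  colon (monomial_ideal
           [seq (lead k l).1 | l <- iota 0 i & (lead k l).2 == (lead k i).2])
        'X_[(lead k i).1].

Fixpoint multideg (k i : nat) : 'X_{1..n} :=
  if k is k'.+1 then ((lead k i).1 + multideg k' (lead k i).2)%MM else 0%MM.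

(* The induced monomial order on [F_k]; [(m, i)] stands for [m e_i]. *)
Fixpoint induced_lt (k : nat) (u v : 'X_{1..n} * nat) : bool :=
  if k is k'.+1 then
    let image w := ((w.1 + (lead k w.2).1)%MM, (lead k w.2).2) in
    induced_lt k' (image u) (image v) ||
    (image u == image v) && (u.2 < v.2)%N
  else grevlex u.1 v.1.

End Frame.

(* [sdiff S k] is the differential [F_(k+1) -> F_k]; its [i]-th row is the
   image of the [i]-th basis element. *)
Record schreyer_data (n : nat) := SchreyerData {
  sgens : nat -> nat -> seq 'X_{1..n};
  sdiff : forall k,
    'M[{mpoly int[n]}]_(size (frame sgens k.+1), size (frame sgens k))
}.

(* The differential sends every basis element to a multihomogeneous element
   with lead term [m e_j], where [(m, j)] is read off the frame.  For [k > 0],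
   once these elements are syzygies, they are the ones obtained by dividing
   [m] times the image of [e_j] with remainder zero: the quotients are, up to
   sign, the remaining terms, all smaller than [m e_j]. *)
Definition has_leads n (S : schreyer_data n) (k : nat) : Prop :=
  forall (i : 'I_(size (frame (sgens S) k.+1)))
         (j : 'I_(size (frame (sgens S) k))),
    (nat_of_ord j = (lead (sgens S) k.+1 i).2 ->
       (sdiff S k i j)@_(lead (sgens S) k.+1 i).1 = 1) /\
    (forall m, m \in msupp (sdiff S k i j) ->
       ((m, nat_of_ord j) = lead (sgens S) k.+1 i \/
        induced_lt (sgens S) k (m, nat_of_ord j) (lead (sgens S) k.+1 i)) /\
       (m + multideg (sgens S) k j)%MM = multideg (sgens S) k.+1 i).

Definition is_schreyer_resolution n (J : {mpoly int[n]} -> Prop)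
    (S : schreyer_data n) : Prop :=
  [/\ is_mingens J (sgens S 0 0),
      forall k i, (i < size (frame (sgens S) k.+1))%N ->
        is_mingens (colon_ideal (sgens S) k.+1 i) (sgens S k.+1 i),
      forall i j, sdiff S 0 i j = 'X_[(lead (sgens S) 1 i).1],
      forall k, has_leads S k
    & forall k, sdiff S k.+1 *m sdiff S k = 0].

Definition is_minimal n (S : schreyer_data n) : Prop :=
  forall k i j, ideal_gen (fun g => exists l : 'I_n, g = 'X_l) (sdiff S k i j).

Section Carpet.

Variables a b : nat.

Definition xvar (i : nat) : {mpoly int[a.+1 + b.+1]} :=
  'X_(lshift b.+1 (inord i : 'I_a.+1)).

Definition yvar (j : nat) : {mpoly int[a.+1 + b.+1]} :=
  'X_(rshift a.+1 (inord j : 'I_b.+1)).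

Definition scroll_mx (R : comNzRingType) (z : nat -> R) (c : nat) :
    'M[R]_(2, c) :=
  \matrix_(r < 2, s < c) z (r + s)%N.

Definition is_minor2 (R : comNzRingType) (c : nat) (A : 'M[R]_(2, c)) (g : R) :
    Prop :=
  exists s t : 'I_c, (s < t)%N /\
    g = \det (colsub (fun e : 'I_2 => if e == 0 then s else t) A).

Definition carpet_gen (g : {mpoly int[a.+1 + b.+1]}) : Prop :=
  [\/ is_minor2 (scroll_mx xvar a) g,
      is_minor2 (scroll_mx yvar b) g
    | exists i j, [/\ (i.+2 <= a)%N, (j.+2 <= b)%N &
        g = xvar i.+2 * yvar j - 2%:R * xvar i.+1 * yvar j.+1
            + xvar i * yvar j.+2]].

Definition carpet_ideal : {mpoly int[a.+1 + b.+1]} -> Prop :=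
  ideal_gen carpet_gen.

End Carpet.

Arguments carpet_ideal : clear implicits.

(* Main.v *)
Require Import Defs.
From mathcomp Require Import all_boot all_order all_algebra.
From mathcomp Require Import mpoly zify.
From Stdlib Require Import ClassicalEpsilon.

(* Within one multidegree the induced monomial order is the order of the
   indices, because the frame is listed parent by parent.  So a Schreyer
   resolution amounts to integer matrices, and a cycle of multidegree [mu] with
   top index [q] must involve an earlier sibling of [q]; hence some generator
   of the colon ideal at [q] divides the cofactor of [q] in [mu], and the
   matrices can be built by division.

   The initial ideal is generated by the quadrics [x_i x_j] and [y_i y_j]
   (interior indices) and [x_i y_j] ([2 <= i], [j <= b - 2]).  Indeed
   [x_i |-> u (t + eps)^i], [y_j |-> v t^j] with [eps^2 = 0] kills the carpet
   ideal, and in each degree of the torus grading the monomials smaller than a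
   given standard one [m] all have [x]-weight one less than that of [m], so
   that no element of the ideal can have leading monomial [m].

   Iterating the colon ideals from these quadrics, one meets only sets of
   variables, possibly with [x_1^2], except at [y_(b-1)^2].  All the
   multidegrees are thus explicit, and each of them determines its homological
   degree; so the differentials have no constant entries. *)

Set Implicit Arguments.
Unset Strict Implicit.
Unset Printing Implicit Defensive.

Import GRing.Theory.
Local Open Scope ring_scope.

(** * Monomial orders and monomial ideals *)

Section Grevlex.
Variable n : nat.
Implicit Types m : 'X_{1..n}.

Lemma grevlexP m1 m2 : mdeg m1 = mdeg m2 ->
  reflect (exists2 i : 'I_n, (m2 i < m1 i)%N &
             forall j : 'I_n, (i < j)%N -> m1 j = m2 j)
          (grevlex m1 m2).
Proof.
move=> E; rewrite /grevlex E ltnn eqxx /=; apply: (iffP existsP).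
  by case=> i /andP[h /forallP H]; exists i => // j hj; apply/eqP/(implyP (H j)).
case=> i h H; exists i; rewrite h /=; apply/forallP=> j; apply/implyP=> hj.
exact/eqP/H.
Qed.

Lemma grevlex_irr m : grevlex m m = false.
Proof. by apply/negP=> /(grevlexP erefl)[i]; rewrite ltnn. Qed.

Lemma grevlex_mdeg m1 m2 : grevlex m1 m2 -> (mdeg m1 <= mdeg m2)%N.
Proof. by rewrite /grevlex; case: ltngtP. Qed.

Lemma grevlex_trans : transitive (@grevlex n).
Proof.
move=> m2 m1 m3 h12 h23.
have := grevlex_mdeg h12; have := grevlex_mdeg h23.
rewrite leq_eqVlt => /predU1P[e23|l23]; last first.
  by move=> l12; rewrite /grevlex (leq_ltn_trans l12 l23).
rewrite leq_eqVlt => /predU1P[e12|l12]; last by rewrite /grevlex -e23 l12.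
have [i hi Hi] := grevlexP e12 h12; have [j hj Hj] := grevlexP e23 h23.
apply/grevlexP; first by rewrite e12.
have [lij|lji|/val_inj eij] := ltngtP i j.
- exists j; first by rewrite Hi.
  by move=> k hk; rewrite Hi ?Hj // (ltn_trans lij).
- exists i; first by rewrite -Hj.
  by move=> k hk; rewrite Hi ?Hj // (ltn_trans lji).
- exists i; first by rewrite (ltn_trans _ hi) // eij.
  by move=> k hk; rewrite Hi ?Hj // -eij.
Qed.

Lemma grevlex_total m1 m2 : mdeg m1 = mdeg m2 -> m1 != m2 ->
  grevlex m1 m2 || grevlex m2 m1.
Proof.
move=> E ne.
have [i0 hi0] : exists i, m1 i != m2 i.
  by apply/existsP; rewrite -negb_forall; apply: contra ne => /forallP H;
     apply/eqP/mnmP=> i; apply/eqP.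
case: (@arg_maxnP _ i0 (fun i => m1 i != m2 i) (fun i : 'I_n => val i) hi0) => i hi max.
have Hi (j : 'I_n) : (i < j)%N -> m1 j = m2 j.
  by move=> hj; apply/eqP; apply: contraLR hj => /max; rewrite -leqNgt.
move: hi; rewrite neq_ltn => /orP[] h; apply/orP.
  by right; apply/grevlexP => //; exists i => // j /Hi.
by left; apply/grevlexP => //; exists i.
Qed.

Lemma schreyer_lt_irr m : schreyer_lt m m = false.
Proof. by rewrite /schreyer_lt ltnn eqxx grevlex_irr. Qed.

Lemma schreyer_lt_mdeg m1 m2 : schreyer_lt m1 m2 -> (mdeg m1 <= mdeg m2)%N.
Proof. by rewrite /schreyer_lt; case: ltngtP. Qed.

Lemma schreyer_lt_trans : transitive (@schreyer_lt n).
Proof.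
move=> m2 m1 m3; rewrite /schreyer_lt.
case: (ltngtP (mdeg m1) (mdeg m2)) => //= [l _|-> h21].
  by case: (ltngtP (mdeg m2) (mdeg m3)) => //= [l' _|<-]; rewrite ?(ltn_trans l l') ?l.
case: ltngtP => //= e h32.
exact: grevlex_trans h32 h21.
Qed.

Lemma schreyer_lt_total m1 m2 : m1 != m2 -> schreyer_lt m1 m2 || schreyer_lt m2 m1.
Proof.
by move=> ne; rewrite /schreyer_lt; case: ltngtP => //= E; rewrite grevlex_total // eq_sym.
Qed.

End Grevlex.

Lemma grevlex_pair n (i j k l : 'I_n) : (i <= j)%N -> (k <= l)%N ->
  (l < j)%N || (l == j) && (k < i)%N ->
  grevlex (U_(i) + U_(j))%MM (U_(k) + U_(l))%MM.
Proof.
move=> hij hkl h.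
have E : mdeg (U_(i) + U_(j))%MM = mdeg (U_(k) + U_(l))%MM by rewrite !mdegD !mdeg1.
apply/(grevlexP E); case/orP: h => [lj|/andP[/eqP elj ki]].
  exists j => [|t ht]; rewrite !mnmDE !mnm1E -!val_eqE /=; last by lia.
  by rewrite eqxx; lia.
exists i => [|t ht]; rewrite !mnmDE !mnm1E elj -!val_eqE /=; last by lia.
by rewrite eqxx; lia.
Qed.

(** Among quadrics the larger of the two indices decides first, and a larger one makes the monomial
    smaller, hence later in the listing. Comparisons thus become index arithmetic. *)
Lemma schreyer_lt_pair n (i j k l : 'I_n) : (i <= j)%N -> (k <= l)%N ->
  schreyer_lt (U_(k) + U_(l))%MM (U_(i) + U_(j))%MM =
  (l < j)%N || (l == j) && (k < i)%N.
Proof.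
move=> hij hkl; have E (p q : 'I_n) : mdeg (U_(p) + U_(q))%MM = 2%N by rewrite mdegD !mdeg1.
rewrite /schreyer_lt !E ltnn eqxx /=; apply/idP/idP => [H|]; last exact: grevlex_pair.
have asym (m : 'X_{1..n}) : grevlex m m -> False by rewrite grevlex_irr.
have [//|lt|/val_inj e] := ltngtP l j.
  by case: (asym _ (grevlex_trans H (grevlex_pair hkl hij _))); rewrite lt.
rewrite e eqxx /=; have [//|lt|/val_inj e'] := ltngtP k i.
  by case: (asym _ (grevlex_trans H (grevlex_pair hkl hij _))); rewrite e eqxx lt orbT.
by move: H; rewrite e e' grevlex_irr.
Qed.

Lemma lead_addX n m (g : {mpoly int[n]}) :
  {in msupp g, forall r, grevlex r m} -> is_lead ('X_[m] + g) m /\ ('X_[m] + g)@_m = 1.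
Proof.
move=> H.
have gm : g@_m = 0.
  by apply/eqP; rewrite mcoeff_eq0; apply/negP=> /H; rewrite grevlex_irr.
have E : ('X_[m] + g)@_m = 1 by rewrite mcoeffD mcoeffX eqxx gm addr0.
split=> //; split; first by rewrite mcoeff_msupp E.
move=> r /msuppD_le; rewrite mem_cat msuppX inE => /orP[/eqP->|/H]; by [left|right].
Qed.

(** * Monomial ideals and their minimal generators *)

Section MonomialIdeals.
Variable n : nat.
Implicit Types (m : 'X_{1..n}) (ms qs : seq 'X_{1..n}) (f : {mpoly int[n]}).

Definition divisible_by ms m := has (fun g => (g <= m)%MM) ms.

Lemma ideal_gen_sum (R : comNzRingType) (S : R -> Prop) (I : eqType) (r : seq I) (F : I -> R) :
  (forall i, i \in r -> ideal_gen S (F i)) -> ideal_gen S (\sum_(i <- r) F i).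
Proof.
elim: r => [|i r IH] H; first by exists [::]; rewrite !big_nil.
rewrite big_cons.
have [s1 [h1 ->]] := H i (mem_head _ _).
have [j hj|s2 [h2 ->]] := IH; first by apply: H; rewrite inE hj orbT.
exists (s1 ++ s2); rewrite big_cat; split=> // p.
by rewrite mem_cat => /orP[/h1|/h2].
Qed.

Lemma ideal_gen_mul (R : comNzRingType) (S : R -> Prop) (c x : R) :
  S x -> ideal_gen S (c * x).
Proof.
by move=> h; exists [:: (c, x)]; rewrite big_seq1; split=> // p; rewrite inE => /eqP->.
Qed.

Lemma ideal_gen_sub (R : comNzRingType) (S S' : R -> Prop) :
  (forall x, S x -> ideal_gen S' x) -> forall x, ideal_gen S x -> ideal_gen S' x.
Proof.
move=> H x [s [hs ->]]; apply: ideal_gen_sum => p /hs/H[s' [hs' ->]].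
exists [seq (p.1 * q.1, q.2) | q <- s']; split; first by move=> q /mapP[q' /hs' ? ->].
by rewrite big_map mulr_sumr; apply: eq_bigr => q _; rewrite mulrA.
Qed.

Lemma monomial_idealP ms f :
  monomial_ideal ms f <-> {in msupp f, forall m, divisible_by ms m}.
Proof.
split=> [[s [hs ->]] m|H].
  move=> /msupp_sum_le /flatten_mapP[p]; rewrite mem_filter /= => hp.
  have [g hg ->] := hs _ hp.
  rewrite (perm_mem (msuppMX _ _)) => /mapP[m' _ ->].
  by apply/hasP; exists g => //; apply: lem_addr.
rewrite [f]mpolyE; apply: ideal_gen_sum => m /H/hasP[g hg hm].
rewrite -(submK hm) mpolyXD scalerAl; apply: ideal_gen_mul.
by exists g.
Qed.

Lemma monomial_idealX ms m : monomial_ideal ms 'X_[m] <-> divisible_by ms m.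
Proof.
rewrite monomial_idealP; split=> [H|H m']; first by apply: H; rewrite msuppX inE.
by rewrite msuppX inE => /eqP->.
Qed.

Lemma colon_monomialP ms m f :
  colon (monomial_ideal ms) 'X_[m] f <->
  {in msupp f, forall g, divisible_by ms (m + g)}.
Proof.
rewrite /colon monomial_idealP; split=> H g hg.
  by apply: H; rewrite (perm_mem (msuppMX _ _)) map_f.
by move: hg; rewrite (perm_mem (msuppMX _ _)) => /mapP[g' /H ? ->].
Qed.

Definition minimal_in qs m := all (fun q => (q <= m)%MM ==> (q == m)) qs.

Lemma lem_mdeg_eq m1 m2 : (m1 <= m2)%MM -> (mdeg m2 <= mdeg m1)%N -> m1 = m2.
Proof.
move=> h; rewrite -{1}(submK h) mdegD => hd.
have /eqP : mdeg (m2 - m1)%MM = 0%N by lia.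
by rewrite mdeg_eq0 => /eqP e; rewrite -(submK h) e add0m.
Qed.

Lemma lem_mdeg m1 m2 : (m1 <= m2)%MM -> (mdeg m1 <= mdeg m2)%N.
Proof. by move=> h; rewrite -(submK h) mdegD leq_addl. Qed.

Lemma minimal_exists qs m : divisible_by qs m ->
  divisible_by [seq q <- qs | minimal_in qs q] m.
Proof.
have [k] := ubnP (mdeg m); elim: k m => // k IH m hk hm.
case/hasP: (hm) => q hq hqm.
have [hmin|] := boolP (minimal_in qs q).
  by apply/hasP; exists q => //; rewrite mem_filter hmin.
case/allPn=> q' hq'; rewrite negb_imply => /andP[hle hne].
have lt : (mdeg q' < mdeg q)%N.
  by rewrite ltnNge; apply: contra hne => /(lem_mdeg_eq hle) ->.
have /hasP[g hg hgq] : divisible_by [seq q <- qs | minimal_in qs q] q'.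
  apply: IH; last by apply/hasP; exists q'; rewrite // lepm_refl.
  have := lem_mdeg hqm; lia.
apply/hasP; exists g => //.
exact: lepm_trans hgq (lepm_trans hle hqm).
Qed.

Definition schreyer_le m1 m2 := (m1 == m2) || schreyer_lt m1 m2.

Definition mingens qs :=
  sort schreyer_le (undup [seq q <- qs | minimal_in qs q]).

Lemma sorted_schreyer_lt ms : uniq ms -> sorted schreyer_le ms ->
  sorted (@schreyer_lt n) ms.
Proof.
case: ms => //= m ms; elim: ms m => //= m' ms IH m /andP[hn hu] /andP[hle hs].
rewrite IH // andbT; move: hle; rewrite /schreyer_le => /predU1P[e|//].
by rewrite e mem_head in hn.
Qed.

Lemma is_mingens_mingens (J : {mpoly int[n]} -> Prop) qs :
  (forall f, J f <-> {in msupp f, forall m, divisible_by qs m}) ->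
  is_mingens J (mingens qs).
Proof.
move=> HJ.
have memE m : (m \in mingens qs) = (minimal_in qs m && (m \in qs)).
  by rewrite mem_sort mem_undup mem_filter.
split.
- move=> f; rewrite HJ monomial_idealP; split=> H m /H h.
    have /hasP[g hg hgm] := minimal_exists h.
    by apply/hasP; exists g => //; rewrite mem_sort mem_undup.
  case/hasP: h => g; rewrite memE => /andP[_ hg] hgm.
  by apply/hasP; exists g.
- move=> m m'; rewrite !memE => /andP[_ hm] /andP[/allP/(_ _ hm)/implyP h _].
  by move=> /h/eqP.
apply: sorted_schreyer_lt; first by rewrite sort_uniq undup_uniq.
apply: sort_sorted => m1 m2; rewrite /schreyer_le.
have [//|ne] := eqVneq m1 m2.
by rewrite /= schreyer_lt_total.
Qed.

Lemma is_mingens_divisible (J : {mpoly int[n]} -> Prop) ms :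
  is_mingens J ms -> forall m, J 'X_[m] <-> divisible_by ms m.
Proof. by case=> H _ _ m; rewrite H monomial_idealX. Qed.

End MonomialIdeals.

(** * Existence of the Schreyer resolution *)

Definition frame_lt n (u v : 'X_{1..n} * nat) : bool :=
  (u.2 < v.2)%N || (u.2 == v.2) && schreyer_lt u.1 v.1.

(** The colon condition on exponent vectors only, so that the construction of the differentials
    needs no polynomials. *)
Definition colon_gens_spec n (gens : nat -> nat -> seq 'X_{1..n}) : Prop :=
  forall k i, (i < size (frame gens k.+1))%N -> forall m,
    divisible_by (gens k.+1 i) m <->
    exists l, [/\ (l < i)%N, (lead gens k.+1 l).2 = (lead gens k.+1 i).2
      & ((lead gens k.+1 l).1 <= m + (lead gens k.+1 i).1)%MM].

(** * Frames and the integer matrices of the differentials *)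

Section FrameTheory.
Variables (n : nat) (gens : nat -> nat -> seq 'X_{1..n}).
Hypothesis gens_sorted : forall k j, (j < size (frame gens k))%N ->
  sorted (@schreyer_lt n) (gens k j).
Hypothesis gens_colon : colon_gens_spec gens.

Notation frame := (frame gens).
Notation lead := (lead gens).
Notation multideg := (multideg gens).
Notation par k i := (lead k.+1 i).2.

Lemma mem_frame k m j :
  ((m, j) \in frame k.+1) = (j < size (frame k))%N && (m \in gens k j).
Proof.
apply/allpairsPdep/andP => [[j' [m' [hj hm [-> ->]]]]|[hj hm]].
  by move: hj; rewrite mem_iota.
by exists j, m; rewrite mem_iota.
Qed.

Lemma lead_mem k i : (i < size (frame k.+1))%N ->
  (par k i < size (frame k))%N && ((lead k.+1 i).1 \in gens k (par k i)).
Proof. by move=> hi; rewrite -mem_frame -surjective_pairing mem_nth. Qed.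

Lemma par_lt k i : (i < size (frame k.+1))%N -> (par k i < size (frame k))%N.
Proof. by move/lead_mem/andP=> []. Qed.

Lemma lead_index k j m : (j < size (frame k))%N -> m \in gens k j ->
  exists2 i, (i < size (frame k.+1))%N & lead k.+1 i = (m, j).
Proof.
move=> hj hm; have h : (m, j) \in frame k.+1 by rewrite mem_frame hj.
by exists (index (m, j) (frame k.+1)); rewrite ?index_mem // /Defs.lead nth_index.
Qed.

Lemma frame_pairwise k : pairwise (@frame_lt n) (frame k.+1).
Proof.
have : forall j, j \in iota 0 (size (frame k)) -> sorted (@schreyer_lt n) (gens k j).
  by move=> j; rewrite mem_iota; apply: gens_sorted.
rewrite /=; elim: (size (frame k)) 0%N => //= s IH x H; rewrite pairwise_cat; apply/and3P; split.
- apply/allrelP=> u v /mapP[m _ ->] /allpairsPdep[j [m' [+ _ ->]]].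
  by rewrite mem_iota /frame_lt /= => /andP[->].
- rewrite pairwise_map; have := H x (mem_head _ _).
  rewrite sorted_pairwise; last exact: schreyer_lt_trans.
  by apply: sub_pairwise => m m' h; rewrite /= /frame_lt /= eqxx h orbT.
- by apply: IH => j hj; apply: H; rewrite inE hj orbT.
Qed.

Lemma lead_mono k i l : (i < l)%N -> (l < size (frame k.+1))%N ->
  frame_lt (lead k.+1 i) (lead k.+1 l).
Proof.
move=> hil hl; have /(pairwiseP (0%MM, 0%N)) H := frame_pairwise k.
by apply: H; rewrite ?inE // (ltn_trans hil).
Qed.

Lemma par_mono k i l : (i <= l)%N -> (l < size (frame k.+1))%N ->
  (par k i <= par k l)%N.
Proof.
rewrite leq_eqVlt => /predU1P[-> //|hil hl].
by have /orP[/ltnW|/andP[/eqP->]] := lead_mono hil hl.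
Qed.

Lemma multidegS k i : multideg k.+1 i = ((lead k.+1 i).1 + multideg k (par k i))%MM.
Proof. by []. Qed.

(** If the parents differ, induction applies to the images; if they agree, equal multidegrees make
    the images coincide and the index breaks the tie. *)
Lemma induced_lt_index k u v :
  (u.1 + multideg k u.2 = v.1 + multideg k v.2)%MM ->
  (u.2 < v.2)%N -> (v.2 < size (frame k))%N -> induced_lt gens k u v.
Proof.
elim: k u v => [|k IH] [m i] [m' l] /=; first by lia.
move=> E hil hl; have := par_mono (ltnW hil) hl.
rewrite leq_eqVlt => /predU1P[e|lt]; apply/orP; [right|left].
  rewrite hil e andbT; apply/eqP; congr (_, _).
  by move: E; rewrite e !addmA => /addIm.
by apply: IH => //=; rewrite -?addmA ?E // par_lt.
Qed.

(** [D i j] is the integer coefficient of an entry of [F_(k+1) -> F_k], whose monomial is forced by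
    the multidegrees. By [induced_lt_index] the bound by the parent is the condition on lead
    terms. *)
Definition good_diff k (D : nat -> nat -> int) : Prop :=
  forall i, (i < size (frame k.+1))%N ->
    D i (par k i) = 1 /\
    forall j, (j < size (frame k))%N -> D i j != 0 ->
      (j <= par k i)%N /\ (multideg k j <= multideg k.+1 i)%MM.

Definition comp_zero k (D' D : nat -> nat -> int) : Prop :=
  forall i j, (i < size (frame k.+2))%N -> (j < size (frame k))%N ->
    \sum_(0 <= l < size (frame k.+1)) D' i l * D l j = 0.

(** [z] is the coefficient vector of an element of [F_k] of multidegree [mu], supported below the
    index [N]. *)
Definition supp_dvd k (mu : 'X_{1..n}) (N : nat) (z : nat -> int) : Prop :=
  forall j, (j < size (frame k))%N -> z j != 0 -> (j < N)%N /\ (multideg k j <= mu)%MM.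

Lemma sum_single s (q : nat) (F : nat -> int) : (q < s)%N ->
  (forall l, l != q -> F l = 0) -> \sum_(0 <= l < s) F l = F q.
Proof.
move=> hq H; rewrite (bigD1_seq q) ?iota_uniq ?mem_index_iota //=.
by rewrite big1 ?addr0 // => l /H.
Qed.

(** Division with remainder zero, from the top index downwards. [Cyc] stays abstract so that one
    argument serves both at the bottom, where it means being zero, and above, where it means being a
    cycle. *)
Lemma reduce_cycles k D (Cyc : (nat -> int) -> Prop) mu :
  good_diff k D ->
  (forall q z, (q < size (frame k))%N -> Cyc z -> supp_dvd k mu q.+1 z -> z q != 0 ->
     exists l, [/\ (l < size (frame k.+1))%N, par k l = q,
       (multideg k.+1 l <= mu)%MM & forall c, Cyc (fun j => z j - c * D l j)]) ->
  forall N z, (N <= size (frame k))%N -> Cyc z -> supp_dvd k mu N z ->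
  exists v : nat -> int,
    (forall l, (l < size (frame k.+1))%N -> v l != 0 ->
       (par k l < N)%N /\ (multideg k.+1 l <= mu)%MM) /\
    forall j, (j < size (frame k))%N ->
      \sum_(0 <= l < size (frame k.+1)) v l * D l j = z j.
Proof.
move=> gD HE; elim=> [|N IH] z hN Cz hz.
  exists (fun _ => 0); split=> [l _|j hj]; first by rewrite eqxx.
  rewrite big1 => [|l _]; last by rewrite mul0r.
  by apply/esym/eqP; apply/negPn/negP => /(hz _ hj)[].
have [z0|nz] := eqVneq (z N) 0.
  have [|v [h1 h2]] := IH z (ltnW hN) Cz.
    move=> j hj nj; have [h1 h2] := hz j hj nj; split=> //.
    rewrite ltn_neqAle -ltnS h1 andbT.
    by apply: contra nj => /eqP->; rewrite z0.
  by exists v; split=> // l hl /(h1 l hl)[h ?]; split=> //; apply: ltnW.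
have [l0 [hl0 hp hm Hc]] := HE N z hN Cz hz nz.
have [D1 D2] := gD l0 hl0; rewrite hp in D1.
(* The row [D l0] has coefficient 1 at [N], so subtracting [z N] times it kills the top coefficient
   without any division in [int]. *)
have [|v [h1 h2]] := IH _ (ltnW hN) (Hc (z N)).
  move=> j hj nj; have [ejN|neN] := eqVneq j N.
    by move: nj; rewrite ejN D1 mulr1 subrr eqxx.
  have [dj|dj] := eqVneq (D l0 j) 0.
    move: nj; rewrite dj mulr0 subr0 => /(hz _ hj)[h1 h2]; split=> //; lia.
  have [h1 h2] := D2 j hj dj; split; last exact: lepm_trans h2 hm.
  rewrite hp in h1; lia.
exists (fun l => v l + (if l == l0 then z N else 0)); split=> [l hl|j hj].
  have [->|ne] := eqVneq l l0; first by rewrite hp.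
  by rewrite addr0 => /(h1 l hl)[h ?]; split=> //; apply: ltnW.
under eq_bigr do rewrite mulrDl.
rewrite big_split /= h2 // (@sum_single _ l0) // ?eqxx ?subrK //.
by move=> l /negPf->; rewrite mul0r.
Qed.

(** In the boundary, the term [z q] at the parent of [q] must be cancelled by some earlier index.
    Its parent is at least that of [q] by [good_diff], and at most that by monotonicity, so it is a
    sibling. *)
Lemma cycle_lead_divisible k D q mu z :
  good_diff k D -> (q < size (frame k.+1))%N ->
  (forall p, (p < size (frame k))%N ->
     \sum_(0 <= j < size (frame k.+1)) z j * D j p = 0) ->
  supp_dvd k.+1 mu q.+1 z -> z q != 0 ->
  exists l, [/\ (l < size (frame k.+2))%N, par k.+1 l = q & (multideg k.+2 l <= mu)%MM].
Proof.
move=> gD hq Hz hs nz.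
have [q' [hq' hlt hp nq']] : exists q',
    [/\ (q' < size (frame k.+1))%N, (q' < q)%N, par k q' = par k q & z q' != 0].
  have := Hz _ (par_lt hq).
  rewrite (bigD1_seq q) ?iota_uniq ?mem_index_iota //= (proj1 (gD q hq)) mulr1.
  move=> E.
  have : has (fun i => (i != q) && (z i * D i (par k q) != 0))
             (index_iota 0 (size (frame k.+1))).
    apply/negPn/negP => /hasPn H; case/eqP: nz; rewrite -E big_seq_cond big1 ?addr0 //.
    by move=> i /andP[hi ni]; have := H i hi; rewrite ni /= negbK => /eqP.
  case/hasP=> i; rewrite mem_index_iota /= => hi /andP[ni].
  rewrite mulf_eq0 negb_or => /andP[zi di].
  have [hiq _] := hs i hi zi.
  have liq : (i < q)%N by lia.
  have [h _] := (proj2 (gD i hi)) _ (par_lt hq) di.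
  exists i; split=> //; apply/eqP; rewrite eqn_leq h andbT.
  by rewrite par_mono // ltnW.
have [_ hmq] := hs q hq nz; have [_ hmq'] := hs q' hq' nq'.
(* The siblings [q] and [q'] both have multidegrees dividing [mu], so the lead monomial of [q']
   divides that of [q] times the cofactor of [q] in [mu]. *)
have : divisible_by (gens k.+1 q) (mu - multideg k.+1 q)%MM.
  apply/(gens_colon hq); exists q'; split=> //.
  move/mnm_lepP: hmq => hmq; move/mnm_lepP: hmq' => hmq'.
  apply/mnm_lepP=> i; have := hmq i; have := hmq' i.
  rewrite !multidegS hp !mnmDE !mnmBE !mnmDE; lia.
case/hasP=> g hg hgm.
have [l hl El] := lead_index hq hg.
exists l; rewrite El; split=> //; rewrite (multidegS k.+1) El -[(g, q).1]/g -[(g, q).2]/q.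
move/mnm_lepP: hgm => hgm; move/mnm_lepP: hmq => hmq.
apply/mnm_lepP=> i; have := hgm i; have := hmq i.
by rewrite (mnmDE i g) (mnmBE i mu); lia.
Qed.

(* [e_j - e_l] with [l] an earlier sibling of [j] maps to a cycle supported
   strictly before the common parent, and so do its reductions. *)
Lemma next_row k D (Cyc : (nat -> int) -> Prop) i :
  good_diff k D ->
  (forall mu q z, (q < size (frame k))%N -> Cyc z -> supp_dvd k mu q.+1 z -> z q != 0 ->
     exists l, [/\ (l < size (frame k.+1))%N, par k l = q,
       (multideg k.+1 l <= mu)%MM & forall c, Cyc (fun j => z j - c * D l j)]) ->
  (forall l j, (l < size (frame k.+1))%N -> (j < size (frame k.+1))%N ->
     par k l = par k j -> Cyc (fun t => D j t - D l t)) ->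
  (i < size (frame k.+2))%N ->
  exists r : nat -> int,
    [/\ r (par k.+1 i) = 1,
        forall j, (j < size (frame k.+1))%N -> r j != 0 ->
          (j <= par k.+1 i)%N /\ (multideg k.+1 j <= multideg k.+2 i)%MM
      & forall j, (j < size (frame k))%N ->
          \sum_(0 <= l < size (frame k.+1)) r l * D l j = 0].
Proof.
move=> gD HE Hdiff hi.
set mu := multideg k.+2 i; have /andP[hj hm] := lead_mem hi.
set j := par k.+1 i in hj hm *.
have : divisible_by (gens k.+1 j) (lead k.+2 i).1.
  by apply/hasP; exists (lead k.+2 i).1; rewrite // lepm_refl.
case/(gens_colon hj) => l [llj epar hdvd].
have hl : (l < size (frame k.+1))%N by apply: ltn_trans hj.
have hmj : (multideg k.+1 j <= mu)%MM by rewrite /mu (multidegS k.+1); apply: lem_addl.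
have hml : (multideg k.+1 l <= mu)%MM.
  move/mnm_lepP: hdvd => h; apply/mnm_lepP=> t; have := h t.
  rewrite /mu (multidegS k.+1) -/j (multidegS k l) (multidegS k j) epar !mnmDE; lia.
have [Dj1 Dj2] := gD j hj; have [Dl1 Dl2] := gD l hl.
have [|v [hv1 hv2]] := reduce_cycles gD (HE mu) (ltnW (par_lt hj)) (Hdiff l j hl hj epar).
  move=> t ht nt.
  have tne : t != par k j.
    by apply: contra nt => /eqP->; rewrite Dj1 -epar Dl1 subrr.
  have [dj|dj] := eqVneq (D j t) 0.
    have [dl|/(Dl2 t ht)[h1 h2]] := eqVneq (D l t) 0; first by rewrite dj dl subrr eqxx in nt.
    by rewrite epar in h1; split; [lia|apply: lepm_trans h2 hml].
  have [h1 h2] := Dj2 t ht dj.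
  by split; [lia|apply: lepm_trans h2 hmj].
(* The row is [e_j - e_l - v]. The support of [v] has parents before that of [j], so it lies before
   [j] and leaves the coefficient 1 there. *)
exists (fun t => (if t == j then 1 else 0) - (if t == l then 1 else 0) - v t); split.
- rewrite eqxx; have -> : (j == l) = false by lia.
  have [-> |/(hv1 j hj)[]] := eqVneq (v j) 0; [by lia|by rewrite ltnn].
- move=> t ht; have [->|tj] := eqVneq t j; first by [].
  have [-> _|tl] := eqVneq t l; first by split=> //; apply: ltnW.
  rewrite !subr0 sub0r oppr_eq0 => /(hv1 t ht)[h1 h2]; split=> //.
  by rewrite leqNgt; apply/negP=> /ltnW hjt; have := par_mono hjt ht; rewrite leqNgt h1.
- move=> t ht; under eq_bigr do rewrite !mulrBl.
  rewrite !sumrB hv2 // (@sum_single _ j) // ?eqxx ?mul1r; last by move=> ? /negPf->; rewrite mul0r.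
  rewrite (@sum_single _ l) // ?eqxx ?mul1r ?subrr //.
  by move=> ? /negPf->; rewrite mul0r.
Qed.

Lemma next_diff k D (Cyc : (nat -> int) -> Prop) :
  good_diff k D ->
  (forall mu q z, (q < size (frame k))%N -> Cyc z -> supp_dvd k mu q.+1 z -> z q != 0 ->
     exists l, [/\ (l < size (frame k.+1))%N, par k l = q,
       (multideg k.+1 l <= mu)%MM & forall c, Cyc (fun j => z j - c * D l j)]) ->
  (forall l j, (l < size (frame k.+1))%N -> (j < size (frame k.+1))%N ->
     par k l = par k j -> Cyc (fun t => D j t - D l t)) ->
  exists D', good_diff k.+1 D' /\ comp_zero k D' D.
Proof.
move=> gD HE Hdiff.
have H i : exists r : nat -> int, (i < size (frame k.+2))%N ->
    [/\ r (par k.+1 i) = 1,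
        forall j, (j < size (frame k.+1))%N -> r j != 0 ->
          (j <= par k.+1 i)%N /\ (multideg k.+1 j <= multideg k.+2 i)%MM
      & forall j, (j < size (frame k))%N ->
          \sum_(0 <= l < size (frame k.+1)) r l * D l j = 0].
  have [hi|hi] := ltnP i (size (frame k.+2)); last by exists (fun _ => 0) => h; lia.
  by have [r hr] := next_row gD HE Hdiff hi; exists r.
pose D' i := proj1_sig (constructive_indefinite_description _ (H i)).
have HD' i := proj2_sig (constructive_indefinite_description _ (H i)).
by exists D'; split=> [i /HD'[]|i j /HD'[_ _ h] /h].
Qed.

Lemma good_diff0 : good_diff 0 (fun _ _ => 1).
Proof.
move=> i hi; split=> // j hj _; split; last by rewrite /=; apply/mnm_lepP=> ?; rewrite mnm0E.
by move: hj => /=; lia.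
Qed.

(** At the bottom all coefficients are 1, so [e_j - e_l] already maps to zero and nothing is left to
    reduce. *)
Lemma next_diff0 : exists D', good_diff 1 D' /\ comp_zero 0 D' (fun _ _ => 1).
Proof.
apply: (@next_diff _ _ (fun z => z =1 fun _ => 0)) => //; first exact: good_diff0.
- by move=> mu q z _ z0 _; rewrite z0 eqxx.
Qed.

Lemma next_diffS k D D1 : good_diff k D -> good_diff k.+1 D1 -> comp_zero k D1 D ->
  exists D2, good_diff k.+2 D2 /\ comp_zero k.+1 D2 D1.
Proof.
move=> gD gD1 D1D.
apply: (@next_diff _ _ (fun z => forall p, (p < size (frame k))%N ->
     \sum_(0 <= j < size (frame k.+1)) z j * D j p = 0)) => //.
- move=> mu q z hq Cz hz nz.
  have [l [hl hp hm]] := cycle_lead_divisible gD hq Cz hz nz.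
  exists l; split=> // c p hp'.
  under eq_bigr do rewrite mulrBl -mulrA.
  by rewrite sumrB Cz // -mulr_sumr D1D // mulr0 subr0.
- move=> l j hl hj _ p hp; under eq_bigr do rewrite mulrBl.
  by rewrite sumrB !D1D // subrr.
Qed.

Lemma diffs_exist : exists D : nat -> nat -> nat -> int,
  [/\ D 0%N = (fun _ _ => 1), forall k, good_diff k (D k)
    & forall k, comp_zero k (D k.+1) (D k)].
Proof.
(* The recursion carries two consecutive matrices, because the next one exists only when these
   compose to zero. *)
pose T k := {p : (nat -> nat -> int) * (nat -> nat -> int) |
  [/\ good_diff k p.1, good_diff k.+1 p.2 & comp_zero k p.2 p.1]}.
have [D1 [g1 c1]] := next_diff0.
pose t0 : T 0%N := exist _ (fun _ _ => 1, D1) (And3 good_diff0 g1 c1).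
have step k (t : T k) : {t' : T k.+1 | (sval t').1 = (sval t).2}.
  case: t => -[D D'] [/= gD gD' c].
  have [D2 [g2 c2]] := constructive_indefinite_description _ (next_diffS gD gD' c).
  by exists (exist _ (D', D2) (And3 gD' g2 c2)).
pose fix t k : T k := if k is k'.+1 then sval (step k' (t k')) else t0.
exists (fun k => (sval (t k)).1); split=> [//|k|k].
  by case: (svalP (t k)).
have -> : (sval (t k.+1)).1 = (sval (t k)).2 by rewrite /= (svalP (step k (t k))).
by case: (svalP (t k)).
Qed.

End FrameTheory.

(** * The frame grown from a given list of monomials *)

Section Existence.
Variables (n : nat) (ms : seq 'X_{1..n}).

(** Frame and generators are computed together, since each needs the other one level below. The
    truncated difference of [m_l] and [m_i] is [m_l / gcd(m_l, m_i)], a generator of the colon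
    ideal. *)
Fixpoint schreyer_level (k : nat) : seq ('X_{1..n} * nat) * (nat -> seq 'X_{1..n}) :=
  if k is k'.+1 then
    let fr := [seq (m, j) | j <- iota 0 (size (schreyer_level k').1),
                            m <- (schreyer_level k').2 j] in
    (fr, fun i =>
       let u := nth (0%MM, 0%N) fr in
       mingens [seq ((u l).1 - (u i).1)%MM | l <- iota 0 i & (u l).2 == (u i).2])
  else ([:: (0%MM, 0%N)], fun _ => ms).

Definition schreyer_gens k := (schreyer_level k).2.

Lemma frame_schreyer_gens k : frame schreyer_gens k = (schreyer_level k).1.
Proof. by elim: k => //= k ->. Qed.

Lemma schreyer_gensS k i : schreyer_gens k.+1 i =
  let u := lead schreyer_gens k.+1 in
  mingens [seq ((u l).1 - (u i).1)%MM | l <- iota 0 i & (u l).2 == (u i).2].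
Proof. by rewrite /lead (frame_schreyer_gens k.+1). Qed.

Lemma is_mingens_schreyer_gens k i :
  is_mingens (colon_ideal schreyer_gens k.+1 i) (schreyer_gens k.+1 i).
Proof.
rewrite schreyer_gensS; apply: is_mingens_mingens => f.
rewrite /colon_ideal colon_monomialP; split=> H m /H.
  rewrite /divisible_by !has_map => /hasP[l hl /= h]; apply/hasP; exists l => //=.
  by apply/mnm_lepP=> t; move/mnm_lepP: h => /(_ t); rewrite mnmDE mnmBE; lia.
rewrite /divisible_by !has_map => /hasP[l hl /= h]; apply/hasP; exists l => //=.
by apply/mnm_lepP=> t; move/mnm_lepP: h => /(_ t); rewrite mnmDE mnmBE; lia.
Qed.

End Existence.

Lemma colon_gens_of_mingens n (gens : nat -> nat -> seq 'X_{1..n}) :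
  (forall k i, (i < size (frame gens k.+1))%N ->
     is_mingens (colon_ideal gens k.+1 i) (gens k.+1 i)) ->
  colon_gens_spec gens.
Proof.
move=> H k i hi m; rewrite -(is_mingens_divisible (H k i hi)).
rewrite /colon_ideal colon_monomialP; split.
  move/(_ m); rewrite msuppX mem_head => /(_ isT).
  rewrite /divisible_by has_map => /hasP[l]; rewrite mem_filter mem_iota /=.
  by move=> /andP[/eqP e hl] h; exists l; split; [lia|exact: e|rewrite addmC].
case=> l [hl e h] g; rewrite msuppX inE => /eqP->.
rewrite /divisible_by has_map; apply/hasP; exists l; last by rewrite /= addmC.
by rewrite mem_filter e eqxx mem_iota.
Qed.

Lemma mingens_sorted n (gens : nat -> nat -> seq 'X_{1..n}) J :
  is_mingens J (gens 0%N 0%N) ->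
  (forall k i, (i < size (frame gens k.+1))%N ->
     is_mingens (colon_ideal gens k.+1 i) (gens k.+1 i)) ->
  forall k j, (j < size (frame gens k))%N -> sorted (@schreyer_lt n) (gens k j).
Proof. by move=> [_ _ h0] H [|k] [|j] // /H[]. Qed.

Theorem schreyer_resolution_exists n (J : {mpoly int[n]} -> Prop) ms :
  is_mingens J ms -> exists S, is_schreyer_resolution J S.
Proof.
move=> HJ; set gens := schreyer_gens ms.
have Hm k i : (i < size (frame gens k.+1))%N ->
    is_mingens (colon_ideal gens k.+1 i) (gens k.+1 i).
  by move=> _; apply: is_mingens_schreyer_gens.
have gs := mingens_sorted (HJ : is_mingens J (gens 0%N 0%N)) Hm.
have gc := colon_gens_of_mingens Hm.
have [D [D0 gD cD]] := diffs_exist gs gc.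
(* Truncated subtraction is harmless here: a nonzero coefficient comes with divisibility of the
   multidegrees. *)
pose d k : 'M[{mpoly int[n]}]_(size (frame gens k.+1), size (frame gens k)) :=
  \matrix_(i, j) (D k i j *: 'X_[multideg gens k.+1 i - multideg gens k j]).
exists (SchreyerData d); split; [exact: HJ|exact: Hm| | |].
- move=> i j; rewrite mxE D0 scale1r; congr 'X_[_].
  by rewrite /= addm0 subm0.
- move=> k i j; have [gD1 gD2] := gD k i (ltn_ord i).
  rewrite (_ : sdiff _ k i j = D k i j *: 'X_[multideg gens k.+1 i - multideg gens k j]);
    last by rewrite mxE.
  change (sgens (SchreyerData d)) with gens.
  split=> [->|m]; first by rewrite gD1 scale1r mcoeffX multidegS addmK eqxx.
  have [->|nz] := eqVneq (D k i j) 0; first by rewrite scale0r msupp0.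
  rewrite msuppMCX // inE => /eqP->.
  have [hle hdvd] := gD2 j (ltn_ord j) nz.
  split; last by rewrite submK.
  move: hle; rewrite leq_eqVlt => /predU1P[e|lt]; [left|right].
    by rewrite e multidegS addmK -surjective_pairing.
  apply: (induced_lt_index gs) => //; last exact: par_lt.
  by rewrite [LHS]submK.
- move=> k; apply/matrixP=> i j; rewrite [LHS]mxE [RHS]mxE.
  (* All nonzero terms of the composite carry the same monomial, which reduces the claim to
     [comp_zero]. *)
  transitivity (\sum_(l < size (frame gens k.+1))
     (D k.+1 i l * D k l j) *: 'X_[multideg gens k.+2 i - multideg gens k j] : {mpoly int[n]}).
    apply: eq_bigr => l _; rewrite [sdiff _ _ _ _]mxE [sdiff _ _ _ j]mxE.
    have [->|n1] := eqVneq (D k.+1 i l) 0; first by rewrite mul0r !scale0r mul0r.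
    have [->|n2] := eqVneq (D k l j) 0; first by rewrite mulr0 !scale0r mulr0.
    have [_ h1] := (proj2 (gD k.+1 i (ltn_ord i))) l (ltn_ord l) n1.
    have [_ h2] := (proj2 (gD k l (ltn_ord l))) j (ltn_ord j) n2.
    rewrite -scalerAl -scalerAr scalerA -mpolyXD; congr (_ *: 'X_[_]).
    by rewrite addmBA // submK.
  rewrite -scaler_suml -(big_mkord xpredT (fun l => D k.+1 i l * D k l j)) cD //.
  by rewrite scale0r.
Qed.

(** * The initial ideal of the carpet *)

Definition weight n (c : 'I_n -> nat) (m : 'X_{1..n}) : nat := (\sum_i c i * m i)%N.

Lemma weightD n (c : 'I_n -> nat) m1 m2 :
  weight c (m1 + m2)%MM = (weight c m1 + weight c m2)%N.
Proof. by rewrite /weight -big_split; apply: eq_bigr => i _; rewrite mnmDE mulnDr. Qed.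

Lemma weight1 n (c : 'I_n -> nat) i : weight c U_(i)%MM = c i.
Proof.
rewrite /weight (bigD1 i) //= mnm1E eqxx muln1 big1 ?addn0 // => j /negPf ne.
by rewrite mnm1E eq_sym ne muln0.
Qed.

Lemma weight_split n (c : 'I_n -> nat) (m : 'X_{1..n}) (i0 : 'I_n) :
  weight c m = (c i0 * m i0 + (\sum_(i < n | (i < i0)%N) c i * m i
                               + \sum_(i < n | (i0 < i)%N) c i * m i))%N.
Proof.
rewrite /weight (bigD1 i0) //=; congr (_ + _)%N.
rewrite (bigID (fun i : 'I_n => (i < i0)%N)) /=; congr (_ + _)%N; apply: eq_bigl => i.
  by rewrite -val_eqE /=; lia.
by rewrite -val_eqE /=; lia.
Qed.

(* [p] marks a block of variables with increasing weights [c] on it; [m] is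
   standard for the corresponding rational normal curve. *)
Lemma std_weight_lt n (p : 'I_n -> bool) (c : 'I_n -> nat) (m m' : 'X_{1..n}) (i0 : 'I_n) :
  p i0 -> (forall j : 'I_n, (i0 < j)%N -> m' j = m j) -> (m i0 < m' i0)%N ->
  weight (fun i => p i : nat) m = weight (fun i => p i : nat) m' ->
  (forall i : 'I_n, (i < i0)%N -> if p i then (c i < c i0)%N else c i == 0%N) ->
  (\sum_(i < n | (i < i0)%N && (0 < c i)%N) m i <= 1)%N ->
  (weight c m < weight c m')%N.
Proof.
move=> pi0 Hgt Hlt; rewrite !(weight_split _ _ i0) pi0 !mul1n => Hp Hc Hs.
have Eg (d : 'I_n -> nat) :
    (\sum_(i < n | (i0 < i)%N) d i * m' i = \sum_(i < n | (i0 < i)%N) d i * m i)%N.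
  by apply: eq_bigr => i /Hgt->.
rewrite !Eg in Hp *.
(* If [c i0 = 0], no variable of the block precedes [i0], and the degrees of [m] and [m'] in the
   block could not agree. *)
have [c0|cpos] := posnP (c i0).
  move: Hp; rewrite (big1 _ (fun i : 'I_n => (i < i0)%N)) => [|i hi]; last first.
    by have := Hc i hi; rewrite c0; case: (p i).
  lia.
(* Before [i0], at most one factor of [m] has positive weight, at most [c i0 - 1]; this is less than
   what the additional [i0] contributes to [m']. *)
have Hle : (\sum_(i < n | (i < i0)%N) c i * m i <= (c i0).-1)%N.
  rewrite (bigID (fun i : 'I_n => (0 < c i)%N)) /= addnC big1 => [|i]; last first.
    by rewrite -eqn0Ngt => /andP[_ /eqP->].
  apply: (@leq_trans (\sum_(i < n | (i < i0)%N && (0 < c i)%N) (c i0).-1 * m i)%N).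
    apply: leq_sum => i /andP[hi hc]; rewrite leq_mul2r; apply/orP; right.
    by have := Hc i hi; case: (p i) => ?; lia.
  by rewrite -big_distrr /= -{2}[(c i0).-1]muln1 leq_mul2l Hs orbT.
have : (c i0 * (m i0).+1 <= c i0 * m' i0)%N by rewrite leq_mul2l Hlt orbT.
rewrite mulnS; lia.
Qed.

(** * Standard monomials, the torus grading and leading terms *)

Section Carpet.
Variables a b : nat.
Hypotheses (ha : (2 <= a)%N) (hb : (2 <= b)%N).
Notation n := (a.+1 + b.+1)%N.
Implicit Types m r : 'X_{1..n}.

(* The variable [x_i] has index [i], the variable [y_j] index [a + 1 + j]. *)
Definition quad_index (i j : nat) : bool :=
  (i <= j)%N && [|| (1 <= i)%N && (j < a)%N,
                    [&& (2 <= i)%N, (i <= a)%N, (a < j)%N & (j < a + b)%N]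
                  | (a.+1 < i)%N && (j <= a + b)%N].

Definition quads : seq 'X_{1..n} :=
  [seq (U_(p.1) + U_(p.2))%MM | p : 'I_n * 'I_n <- enum {: 'I_n * 'I_n} & quad_index p.1 p.2].

Lemma quadsP m : reflect (exists i j : 'I_n, quad_index i j /\ m = (U_(i) + U_(j))%MM)
  (m \in quads).
Proof.
apply: (iffP mapP) => [[[i j]]|[i [j [h ->]]]].
  by rewrite mem_filter => /andP[h _] ->; exists i, j.
by exists (i, j); rewrite // mem_filter h mem_enum.
Qed.

Lemma std_quad m (i j : 'I_n) : ~~ divisible_by quads m -> quad_index i j ->
  (0 < m i)%N -> (0 < m j)%N -> i = j /\ m i = 1%N.
Proof.
move=> /hasPn std hq hi hj.
have /std H : (U_(i) + U_(j))%MM \in quads by apply/quadsP; exists i, j.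
have [e|ne] := eqVneq i j; [split=> //|exfalso]; last first.
  case/negP: H; apply/mnm_lepP=> k; rewrite mnmDE !mnm1E.
  have [<-|_] := eqVneq i k; first by rewrite eq_sym (negPf ne) addn0.
  by have [<-|_] := eqVneq j k.
apply/eqP; rewrite eqn_leq hi andbT leqNgt; apply: contra H => hlt.
apply/mnm_lepP=> k; rewrite mnmDE !mnm1E -e.
by have [<-|] := eqVneq i k; lia.
Qed.

(** Two factors from [Q], equal or not, would give a quadric dividing [m]. *)
Lemma std_sum_le1 (Q : pred 'I_n) m : ~~ divisible_by quads m ->
  (forall i j : 'I_n, Q i -> Q j -> (i <= j)%N -> quad_index i j) ->
  (\sum_(i | Q i) m i <= 1)%N.
Proof.
move=> std HQ.
have [/existsP[i /andP[hQ hi]]|] := boolP [exists i, Q i && (0 < m i)%N]; last first.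
  move/existsPn=> H; rewrite big1 // => i hQ; have := H i; rewrite hQ /=; lia.
have [_ mi] := std_quad std (HQ i i hQ hQ (leqnn _)) hi hi.
rewrite (bigD1 i) //= mi big1 // => j /andP[hQj ne].
apply/eqP; rewrite -leqn0 leqNgt; apply: contra ne => hj.
have [/HQ h|/ltnW/HQ h] := leqP i j.
  by have [-> _] := std_quad std (h hQ hQj) hi hj.
by have [-> _] := std_quad std (h hQj hQ) hj hi.
Qed.

Definition xw (i : 'I_n) : nat := if (i <= a)%N then nat_of_ord i else 0%N.
Definition yw (i : 'I_n) : nat := if (i <= a)%N then 0%N else (i - a.+1)%N.
Definition isx (i : 'I_n) : nat := (i <= a)%N.
Definition isy (i : 'I_n) : nat := (a < i)%N.

(* The torus grading of the carpet: degree in [x], degree in [y], total weight. *)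
Definition same_class m m' : bool :=
  [&& weight isx m == weight isx m', weight isy m == weight isy m'
    & weight (fun i => xw i + yw i)%N m == weight (fun i => xw i + yw i)%N m'].

Lemma weight_add (c d : 'I_n -> nat) m :
  weight (fun i => c i + d i)%N m = (weight c m + weight d m)%N.
Proof. by rewrite /weight -big_split; apply: eq_bigr => i _; rewrite mulnDl. Qed.

Lemma same_class_mdeg m m' : same_class m m' -> mdeg m = mdeg m'.
Proof.
have E r : mdeg r = (weight isx r + weight isy r)%N.
  rewrite mdegE -weight_add; apply: eq_bigr => i _.
  by rewrite /isx /isy ltnNge; case: leqP => _; rewrite mul1n.
by case/and3P=> /eqP h1 /eqP h2 _; rewrite !E h1 h2.
Qed.

(** Let [i0] be the last variable in which the monomials differ. If it is an [x], the [y]-parts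
    agree and [std_weight_lt] contradicts the total weight. If it is a [y], then [m'] has larger
    [y]-weight, and it remains to bound the gap by one. *)
Lemma std_class m m' : ~~ divisible_by quads m -> same_class m' m -> grevlex m' m ->
  (weight xw m').+1 = weight xw m.
Proof.
move=> std cl /(grevlexP (same_class_mdeg cl))[i0 hi0 Heq].
case/and3P: cl => /eqP clx /eqP cly; rewrite !weight_add => /eqP clw.
have [hx|hy] := leqP i0 a.
  have : (weight xw m < weight xw m')%N.
    apply: (@std_weight_lt _ (fun i => i <= a)%N _ _ _ i0) => //.
    - by move=> i hi; rewrite /xw hx (_ : (i <= a)%N = true) //; lia.
    - apply: std_sum_le1 => // i j; rewrite /xw /quad_index.
      by case: (leqP i a); case: (leqP j a); lia.
  have : weight yw m' = weight yw m.
    apply: eq_bigr => i _; rewrite /yw; case: leqP => // hi.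
    by rewrite Heq // (leq_ltn_trans hx).
  lia.
have ylt : (weight yw m < weight yw m')%N.
  apply: (@std_weight_lt _ (fun i => a < i)%N _ _ _ i0) => //.
  - move=> i hi; rewrite /yw; case: (ltnP a i); case: (leqP i0 a); lia.
  - apply: std_sum_le1 => // i j; rewrite /yw /quad_index; have := ltn_ord i0.
    by case: (leqP i a); case: (leqP j a); lia.
suff : (weight xw m <= (weight xw m').+1)%N by lia.
rewrite leqNgt; apply/negP=> lt.
(* Without any [x_i], [2 <= i], the [x]-weight of [m] is at most 1, as [x_1^2] is a quadric. With
   one, only [y_(b-1)], at most once, and [y_b] can divide [m], so its [y]-weight is within one of
   the maximum for its [y]-degree. *)
have [/existsP[i /and3P[hi hia mi]]|] :=
    boolP [exists i : 'I_n, [&& (1 < i)%N, (i <= a)%N & (0 < m i)%N]]; last first.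
  move/existsPn=> H.
  have : (weight xw m <= 1)%N.
    apply: (@leq_trans (\sum_(i < n | (i == 1%N :> nat)) m i)%N).
      rewrite /weight [X in (_ <= X)%N]big_mkcond; apply: leq_sum => i _.
      have := H i; rewrite /xw; have [->|mi] := posnP (m i); first by rewrite muln0.
      case: (leqP i a) => hi; last by [].
      case: eqP => [->|ne]; first by rewrite mul1n.
      by move=> h; rewrite (_ : nat_of_ord i = 0%N) //; lia.
    apply: std_sum_le1 => // i j; rewrite /quad_index; lia.
  lia.
have my0 (j : 'I_n) : (a < j)%N -> (j < a + b)%N -> m j = 0%N.
  move=> h1 h2; apply/eqP; rewrite -leqn0 leqNgt; apply/negP=> mj.
  have hq : quad_index i j by rewrite /quad_index; lia.
  have [e _] := std_quad std hq mi mj; move: hia; rewrite e; lia.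
have Ele : (b * weight isy m <= weight yw m + 1)%N.
  have h1 : (\sum_(i < n | (i == a + b :> nat)%N) m i <= 1)%N.
    apply: std_sum_le1 => // k l; rewrite /quad_index; lia.
  apply: (leq_trans _ (leq_add (leqnn _) h1)).
  rewrite /weight big_distrr /=.
  rewrite (big_mkcond (fun k : 'I_n => nat_of_ord k == (a + b)%N)) -big_split /=.
  apply: leq_sum => k _; rewrite /isy /yw.
  have [hk|hk] := leqP k a; first by rewrite mul0n muln0.
  rewrite mul1n; case: eqP => [ek|nk].
    rewrite (_ : (k - a.+1 = b.-1)%N); last by lia.
    by move: (m k) => M; rewrite -mulSnr prednK //; lia.
  rewrite addn0; have [hk'|hk'] := ltnP k (a + b); first by rewrite my0 // !muln0.
  by rewrite leq_mul2r; apply/orP; right; lia.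
have Ege : (weight yw m' <= b * weight isy m')%N.
  rewrite /weight big_distrr /=; apply: leq_sum => k _; rewrite mulnA leq_mul2r.
  by apply/orP; right; rewrite /yw /isy; case: leqP => // hk; have := ltn_ord k; lia.
rewrite cly in Ege; lia.
Qed.

(* In the class of [m0], with [x]-weight [e], the image under the ring map of
   the header is the pair of the sums of [f@_m] and [f@_m * weight xw m]; this
   is the combination vanishing on monomials of [x]-weight [e - 1]. *)
Definition class_value m0 m : int :=
  if same_class m m0 then (weight xw m)%:Z + 1 - (weight xw m0)%:Z else 0.

(** The degree bound only makes the sum finite: [class_value] vanishes in every degree other than
    that of [m0]. *)
Definition functional m0 (f : {mpoly int[n]}) : int :=
  \sum_(m : 'X_{1..n < (mdeg m0).+1}) f@_m * class_value m0 m.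

Lemma functionalX m0 r : functional m0 'X_[r] = class_value m0 r.
Proof.
rewrite /functional; have [lt|ge] := ltnP (mdeg r) (mdeg m0).+1.
  rewrite (bigD1 (BMultinom lt)) //= mcoeffX eqxx mul1r big1 ?addr0 // => m ne.
  rewrite mcoeffX; case: eqP => [e|_]; last by rewrite mul0r.
  by case/eqP: ne; apply/val_inj; rewrite /= e.
rewrite big1 => [|m _].
  rewrite /class_value; case: ifP => // /same_class_mdeg e; lia.
rewrite mcoeffX; case: eqP => [e|_]; last by rewrite mul0r.
by have := bmdeg m; rewrite -e; lia.
Qed.

Lemma functional_sum m0 (I : Type) (s : seq I) (c : I -> int) (F : I -> {mpoly int[n]}) :
  functional m0 (\sum_(i <- s) c i *: F i) = \sum_(i <- s) c i * functional m0 (F i).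
Proof.
rewrite /functional; under eq_bigr do rewrite raddf_sum mulr_suml.
rewrite exchange_big; apply: eq_bigr => i _; rewrite mulr_sumr.
by apply: eq_bigr => m _; rewrite /= mcoeffZ mulrA.
Qed.

Lemma functionalZ m0 c f : functional m0 (c *: f) = c * functional m0 f.
Proof. by have := @functional_sum m0 _ [:: tt] (fun _ => c) (fun _ => f); rewrite !big_seq1. Qed.

Lemma functionalD m0 f g : functional m0 (f + g) = functional m0 f + functional m0 g.
Proof.
rewrite /functional -big_split; apply: eq_bigr => m _.
by rewrite mcoeffD mulrDl.
Qed.

(** One numbering for all variables: [x_i] is [var i] and [y_j] is [var (a.+1 + j)]. The minors of
    both matrices then have the same form. *)
Definition var (t : nat) : 'I_n := inord t.

Lemma val_var t : (t < n)%N -> nat_of_ord (var t) = t.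
Proof. exact: inordK. Qed.

Lemma xvarE i : (i <= a)%N -> xvar a b i = 'X_(var i).
Proof.
move=> hi; rewrite /xvar; congr 'X_(_); apply/val_inj.
by rewrite /= inordK // val_var //; lia.
Qed.

Lemma yvarE j : (j <= b)%N -> yvar a b j = 'X_(var (a.+1 + j)).
Proof.
move=> hj; rewrite /yvar; congr 'X_(_); apply/val_inj.
by rewrite /= inordK // val_var //; lia.
Qed.

Definition binomial_gen s t : {mpoly int[n]} :=
  'X_[U_(var s) + U_(var t.+1)] - 'X_[U_(var s.+1) + U_(var t)].

Definition mixed_gen s t : {mpoly int[n]} :=
  'X_[U_(var s.+2) + U_(var t)] - 2%:R *: 'X_[U_(var s.+1) + U_(var t.+1)]
  + 'X_[U_(var s) + U_(var t.+2)].

Lemma minor2E (R : comNzRingType) (z : nat -> R) c (s t : 'I_c) :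
  \det (colsub (fun e : 'I_2 => if e == 0 then s else t) (scroll_mx z c)) =
  z s * z t.+1 - z s.+1 * z t.
Proof.
rewrite (expand_det_row _ ord0) !big_ord_recl big_ord0 addr0.
rewrite /cofactor !det_mx11 !mxE /= !addn0 !addn1 expr0 expr1 !mulN1r ?mul1r.
by rewrite !add0n mulrN [z t * _]mulrC.
Qed.

Lemma carpet_genP g : carpet_gen g <->
  (exists s t, [/\ (s < t)%N, (t < a)%N || (a < s)%N && (t <= a + b)%N
     & g = binomial_gen s t]) \/
  (exists s t, [/\ (s.+2 <= a)%N, (a < t)%N, (t < a + b)%N & g = mixed_gen s t]).
Proof.
have Emix i j : (i.+2 <= a)%N -> (j.+2 <= b)%N ->
    xvar a b i.+2 * yvar a b j - 2%:R * xvar a b i.+1 * yvar a b j.+1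
      + xvar a b i * yvar a b j.+2 = mixed_gen i (a.+1 + j).
  move=> hi hj; rewrite !xvarE ?yvarE; try lia.
  by rewrite /mixed_gen !mpolyXD -mulrA (addnS a.+1 j.+1) (addnS a.+1 j) scaler_nat mulr_natl.
split.
- case=> [[s [t [h ->]]]|[s [t [h ->]]]|[i [j [hi hj ->]]]].
  + left; exists s, t; have hs := ltn_ord s; have ht := ltn_ord t.
    rewrite h ht minor2E /binomial_gen !mpolyXD; split=> //.
    by rewrite !xvarE //; lia.
  + left; exists (a.+1 + s)%N, (a.+1 + t)%N; have hs := ltn_ord s; have ht := ltn_ord t.
    rewrite minor2E /binomial_gen !mpolyXD -(addnS a.+1 s) -(addnS a.+1 t); split; try lia.
    by rewrite !yvarE //; lia.
  + right; exists i, (a.+1 + j)%N; rewrite Emix //; split=> //; lia.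
- case=> [[s [t [h1 h2 ->]]]|[s [t [h1 h2 h3 ->]]]].
  + case/orP: h2 => [h2|/andP[h2 h3]]; [apply: Or31|apply: Or32].
      have hs : (s < a)%N by lia.
      exists (Ordinal hs), (Ordinal h2); split=> //.
      by rewrite minor2E /binomial_gen !mpolyXD /= !xvarE //; lia.
    have hs : (s - a.+1 < b)%N by lia.
    have ht : (t - a.+1 < b)%N by lia.
    exists (Ordinal hs), (Ordinal ht); split; first by rewrite /=; lia.
    rewrite minor2E /binomial_gen !mpolyXD /= !yvarE; try lia.
    by rewrite (addnS a.+1 (s - a.+1)) (addnS a.+1 (t - a.+1)) !subnKC //; lia.
  + apply: Or33; exists s, (t - a.+1)%N; split=> //; first by lia.
    by rewrite Emix ?subnKC //; lia.
Qed.

(** All terms of a generator lie in one class. The two terms of a minor have the same [x]-weight;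
    those of a mixed form have [x]-weights in arithmetic progression, and the coefficients 1, -2, 1
    annihilate affine functions of it. *)
Lemma functional_gen m0 r g : carpet_gen g -> functional m0 ('X_[r] * g) = 0.
Proof.
case/carpet_genP => [[s [t [h1 h2 ->]]]|[s [t [h1 h2 h3 ->]]]].
- rewrite /binomial_gen mulrBr -!mpolyXD functionalD -scaleN1r functionalZ !functionalX mulN1r.
  have E c : (c (var s) + c (var t.+1) = c (var s.+1) + c (var t))%N ->
      weight c (r + (U_(var s) + U_(var t.+1)))%MM =
      weight c (r + (U_(var s.+1) + U_(var t)))%MM.
    by move=> e; rewrite !weightD !weight1 e.
  rewrite /class_value /same_class !E ?subrr // /isx /isy /xw /yw !val_var; try lia;
    by repeat case: ifP => ?; lia.
- rewrite /mixed_gen mulrDr mulrBr -scalerAr -!mpolyXD !functionalD.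
  rewrite -scaleN1r !functionalZ !functionalX.
  have E c : (c (var s.+2) + c (var t) = c (var s) + c (var t.+2))%N ->
      weight c (r + (U_(var s.+2) + U_(var t)))%MM =
      weight c (r + (U_(var s) + U_(var t.+2)))%MM.
    by move=> e; rewrite !weightD !weight1 e.
  have E' c : (c (var s.+1) + c (var t.+1) = c (var s) + c (var t.+2))%N ->
      weight c (r + (U_(var s.+1) + U_(var t.+1)))%MM =
      weight c (r + (U_(var s) + U_(var t.+2)))%MM.
    by move=> e; rewrite !weightD !weight1 e.
  rewrite /class_value /same_class.
  rewrite !(E isx) ?(E isy) ?(E (fun i => xw i + yw i)%N)
    ?(E' isx) ?(E' isy) ?(E' (fun i => xw i + yw i)%N);
    try by rewrite /isx /isy /xw /yw !val_var; try lia; repeat case: ifP => ?; lia.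
  case: ifP => _; last by rewrite !mulr0 subr0.
  rewrite !weightD !weight1 /xw !val_var; try lia.
  by repeat case: ifP => ?; lia.
Qed.

Lemma functional_carpet m0 f : carpet_ideal a b f -> functional m0 f = 0.
Proof.
case=> s [hs ->].
rewrite (eq_bigr (fun p => 1 *: (p.1 * p.2))) => [|p _]; last by rewrite scale1r.
rewrite functional_sum big_seq big1 // => p /hs hp; rewrite mul1r.
rewrite [p.1]mpolyE mulr_suml.
under eq_bigr do rewrite -scalerAl.
by rewrite functional_sum big1 // => r _; rewrite functional_gen // mulr0.
Qed.

(** If [m] were standard, [functional m] would take the value 1 on [m] and, by [std_class], 0 on the
    smaller monomials of [f]; it would return the coefficient of [m], yet it vanishes on the
    ideal. *)
Lemma carpet_lead_divisible f m : carpet_ideal a b f -> is_lead f m ->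
  divisible_by quads m.
Proof.
move=> hf [hm hl]; apply/negPn/negP => std.
have := functional_carpet m hf; rewrite [f]mpolyE functional_sum.
rewrite (bigD1_seq m) //= functionalX (_ : class_value m m = 1); last first.
  by rewrite /class_value /same_class !eqxx /=; lia.
rewrite big_seq_cond big1 => [|m' /andP[hm' ne]].
  rewrite addr0 mulr1 => e.
  by move: hm; rewrite mcoeff_msupp e eqxx.
rewrite functionalX /class_value; case: ifP => [cl|]; last by rewrite mulr0.
have [e|lt] := hl m' hm'; first by rewrite e eqxx in ne.
by rewrite -(std_class std cl lt); lia.
Qed.

(** In each generator, suitably signed, the other terms involve a later last variable. The leading
    coefficient 1 matters: over [int] it is what makes the initial ideal a monomial ideal. *)
Lemma quad_initial m : m \in quads ->
  exists2 f, carpet_ideal a b f & is_lead f m /\ f@_m = 1.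
Proof.
case/quadsP=> i [j [hq ->]].
have vi : var i = i by apply/val_inj/val_var.
have vj : var j = j by apply/val_inj/val_var.
have hi := ltn_ord i; have hj := ltn_ord j.
have [hmix|hbin] := boolP ((i <= a)%N && (a < j)%N).
  exists (mixed_gen i.-2 j).
    rewrite -[X in carpet_ideal _ _ X]mul1r; apply/ideal_gen_mul/carpet_genP; right.
    by exists i.-2, j; split=> //; move: hq; rewrite /quad_index; lia.
  have Ei : (i.-2).+2 = i by move: hq; rewrite /quad_index; lia.
  rewrite /mixed_gen Ei vi vj -addrA; apply: lead_addX => r.
  move=> /msuppD_le; rewrite mem_cat msuppX inE (perm_mem (msuppN _)).
  case/orP=> [/msuppZ_le|/eqP->]; first rewrite msuppX inE => /eqP->.
  - apply: grevlex_pair; rewrite ?val_var; move: hq; rewrite /quad_index; lia.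
  - apply: grevlex_pair; rewrite ?val_var; move: hq; rewrite /quad_index; lia.
exists (- binomial_gen i.-1 j).
  rewrite -mulN1r; apply/ideal_gen_mul/carpet_genP; left.
  by exists i.-1, j; split=> //; move: hq hbin; rewrite /quad_index; lia.
have Ei : (i.-1).+1 = i by move: hq hbin; rewrite /quad_index; lia.
rewrite /binomial_gen Ei vi vj opprB; apply: lead_addX => r.
rewrite (perm_mem (msuppN _)) msuppX inE => /eqP->.
apply: grevlex_pair; rewrite ?val_var; move: hq hbin; rewrite /quad_index; lia.
Qed.

Theorem initial_carpetP f : initial_ideal (carpet_ideal a b) f <->
  {in msupp f, forall m, divisible_by quads m}.
Proof.
rewrite -monomial_idealP; split; apply: ideal_gen_sub => g.
  move=> [h [m [hI hl ->]]]; rewrite -[_ *: _]mul_mpolyC.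
  have /monomial_idealX := carpet_lead_divisible hI hl.
  case=> s [hs ->]; exists [seq ((h@_m)%:MP * q.1, q.2) | q <- s]; split.
    by move=> q /mapP[q' /hs ? ->].
  by rewrite big_map mulr_sumr; apply: eq_bigr => q _; rewrite mulrA.
case=> m /quad_initial[h hI [hl h1] ->].
rewrite -[X in ideal_gen _ X]mul1r; apply: ideal_gen_mul.
by exists h, m; split=> //; rewrite h1 scale1r.
Qed.

End Carpet.

(** * Minimality *)

Definition antichain n (G : seq 'X_{1..n}) : Prop :=
  {in G &, forall m m', (m <= m')%MM -> m = m'}.

(** The colon ideal at [m] in terms of the generator list containing [m], with positions in the
    frame forgotten. *)
Definition child_gens n (G0 : seq 'X_{1..n}) (m : 'X_{1..n}) (G : seq 'X_{1..n}) : Prop :=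
  forall g, divisible_by G g <->
    exists h, [/\ h \in G0, schreyer_lt h m & (h <= g + m)%MM].

Lemma child_gens_of_colon n (gens : nat -> nat -> seq 'X_{1..n}) k i :
  (forall k j, (j < size (frame gens k))%N -> sorted (@schreyer_lt n) (gens k j)) ->
  colon_gens_spec gens -> (i < size (frame gens k.+1))%N ->
  child_gens (gens k (lead gens k.+1 i).2) (lead gens k.+1 i).1 (gens k.+1 i).
Proof.
move=> gs gc hi g; rewrite (gc k i hi g); have /andP[hj hm] := lead_mem hi.
split=> [[l [hl e hle]]|[h [hh hlt hle]]].
  have hl' := ltn_trans hl hi; have /andP[_ hml] := lead_mem hl'.
  exists (lead gens k.+1 l).1; split=> //; first by rewrite -e.
  have := lead_mono gs hl hi; rewrite /frame_lt e ltnn eqxx /=; done.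
have [l hl El] := lead_index hj hh.
exists l; rewrite El; split=> //.
have [//|li|e] := ltngtP l i.
  have := lead_mono gs li hl; rewrite /frame_lt El ltnn eqxx /= => h'.
  by have := schreyer_lt_trans hlt h'; rewrite schreyer_lt_irr.
by move: hlt; rewrite -e El /= schreyer_lt_irr.
Qed.

(** * Recognizing the generators of one colon ideal *)

Section Child.
Variables (n : nat) (G0 : seq 'X_{1..n}) (m : 'X_{1..n}) (G : seq 'X_{1..n}).
Hypotheses (GP : child_gens G0 m G) (aG : antichain G).

Lemma child_minimal g g' h : g \in G -> h \in G0 -> schreyer_lt h m ->
  (h <= g' + m)%MM -> (g' <= g)%MM -> g = g'.
Proof.
move=> hg hh hlt hle hgg.
have /hasP[g2 hg2 le2] : divisible_by G g' by apply/GP; exists h.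
have e : g2 = g by apply: aG => //; apply: lepm_trans le2 hgg.
by apply: lem_mdeg_eq; [rewrite -e|apply: lem_mdeg].
Qed.

Lemma child_earlier g : g \in G ->
  exists h, [/\ h \in G0, schreyer_lt h m & (h <= g + m)%MM].
Proof. by move=> hg; apply/GP; apply/hasP; exists g; rewrite // lepm_refl. Qed.

(** Being coprime to [m], [h] divides [g]; it also lies in the colon ideal, so minimality of [g]
    gives equality. *)
Lemma child_coprime g h : g \in G -> h \in G0 -> schreyer_lt h m -> (h <= g + m)%MM ->
  (forall t, h t = 0%N \/ m t = 0%N) -> g = h.
Proof.
move=> hg hh hlt /mnm_lepP hle hco; apply: (child_minimal hg hh hlt (lem_addr _ _)).
apply/mnm_lepP=> t; have := hle t; rewrite mnmDE.
by case: (hco t) => ->; rewrite ?addn0.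
Qed.

(** With [s] a factor of [m], the earlier product of the variables [t] and [s] divides [m] times the
    variable [t], which therefore lies in the colon ideal. *)
Lemma child_variable (i j s t : 'I_n) g : m = (U_(i) + U_(j))%MM -> (i <= j)%N ->
  g \in G -> divisible_by G0 (U_(t) + U_(s))%MM -> s = i \/ s = j ->
  (maxn t s < j)%N || (maxn t s == j) && (minn t s < i)%N ->
  (0 < g t)%N -> g = U_(t)%MM.
Proof.
move=> em hij hg /hasP[h hh hle] hs hord gt0.
apply: (child_minimal hg hh) => //; last by rewrite lep1mP -lt0n.
  have [e|ne] := eqVneq h (U_(t) + U_(s))%MM.
    rewrite e em; have [le|/ltnW le] := leqP t s.
      by rewrite schreyer_lt_pair //; move: hord; rewrite -!val_eqE /=; lia.
    by rewrite addmC schreyer_lt_pair //; move: hord; rewrite -!val_eqE /=; lia.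
  rewrite /schreyer_lt em (_ : (mdeg h < _)%N) // ltnNge.
  apply: contra ne => hd; apply/eqP/lem_mdeg_eq => //.
  by move: hd; rewrite !mdegD !mdeg1.
apply: lepm_trans hle _; rewrite em; apply/mnm_lepP=> u.
by rewrite !mnmDE !mnm1E; case: hs => ->; lia.
Qed.

End Child.

Section Minimality.
Variables a b : nat.
Hypotheses (ha : (2 <= a)%N) (hb : (2 <= b)%N).
Notation n := (a.+1 + b.+1)%N.
Notation x1 := (var a b 1).
Notation xa := (var a b a).
Notation y0 := (var a b a.+1).
Notation yB := (var a b (a + b)).
Notation xdeg := (weight (@isx a b)).
Notation ydeg := (weight (@isy a b)).
Implicit Types (m mu r g h : 'X_{1..n}) (G : seq 'X_{1..n}).

Let v1 : nat_of_ord x1 = 1%N. Proof. by rewrite val_var //; lia. Qed.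
Let va : nat_of_ord xa = a. Proof. by rewrite val_var //; lia. Qed.
Let v0 : nat_of_ord y0 = a.+1. Proof. by rewrite val_var //; lia. Qed.
Let vB : nat_of_ord yB = (a + b)%N. Proof. by rewrite val_var //; lia. Qed.

(* [mdeg mu - 1 - homological degree], read off the multidegree alone; this
   rules out unit entries in the differentials. *)
Definition excess mu : nat :=
  if (2 <= mu yB)%N then
    ((0 < xdeg mu) + [&& 2 <= mu x1, 1 <= mu xa & 1 <= mu y0])%N
  else ((2 <= mu x1) && (0 < ydeg mu))%N.

(** [r] is a product of distinct variables belonging to [G]. *)
Definition supported r G : Prop := forall t, (r t <= (U_(t)%MM \in G))%N.

(** From here on the multidegrees are [mu] times products of distinct elements of [G], as in a
    Koszul complex. The conditions on [excess] range over all such products, so that they are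
    inherited. *)
Definition koszul_state mu G : Prop :=
  [/\ {in G, forall g, g = (U_(x1) + U_(x1))%MM \/ exists t, g = U_(t)%MM},
      forall r, supported r G -> excess (mu + r)%MM = excess mu
    & (U_(x1) + U_(x1))%MM \in G -> forall r, supported r G ->
        excess (mu + (U_(x1) + U_(x1)) + r)%MM = (excess mu).+1].

Lemma koszul_coprime mu G g h : koszul_state mu G -> antichain G ->
  g \in G -> h \in G -> g != h -> forall t, g t = 0%N \/ h t = 0%N.
Proof.
move=> [HG _ _] aG hg hh ne t.
have [gt0|gt] := posnP (g t); first by left.
have [ht0|ht] := posnP (h t); first by right.
have sq (s : 'I_n) : U_(s)%MM \in G -> (U_(x1) + U_(x1))%MM \in G ->
    (0 < (U_(x1) + U_(x1))%MM t)%N -> (0 < U_(s)%MM t)%N -> False.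
  rewrite mnmDE !mnm1E => h1 h2 h3 h4.
  have e1 : x1 = t by apply/eqP; move: h3; case: (x1 == t).
  have e2 : s = t by apply/eqP; move: h4; case: (s == t).
  have := aG _ _ h1 h2; rewrite e1 e2 => /(_ (lem_addr _ _)) /(congr1 (@mdeg _)).
  by rewrite mdegD mdeg1.
case: (HG g hg) (HG h hh) => [eg|[s eg]] [eh|[s' eh]].
- by rewrite eg eh eqxx in ne.
- by case: (sq s'); rewrite -?eg -?eh.
- by case: (sq s); rewrite -?eg -?eh.
- case/eqP: ne; rewrite eg eh; move: gt ht; rewrite eg eh !mnm1E.
  by case: (eqVneq s t) => // ->; case: (eqVneq s' t) => // ->.
Qed.

(** The elements of [G0] are pairwise coprime, so the colon ideal at [m] is generated by those
    preceding [m]. *)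
Lemma koszul_child mu G0 m G : koszul_state mu G0 -> antichain G0 -> m \in G0 ->
  child_gens G0 m G -> antichain G ->
  koszul_state (m + mu)%MM G /\
  (excess (m + mu)%MM).+1 = (mdeg m + excess mu)%N.
Proof.
move=> K0 aG0 hm GP aG; have [H1 H2 H3] := K0.
have sub g : g \in G -> g \in G0 /\ g != m.
  move=> hg; have [h [hh hlt hle]] := child_earlier GP hg.
  have ne : h != m by apply: contraTneq hlt => ->; rewrite schreyer_lt_irr.
  by rewrite (child_coprime GP aG hg hh hlt hle (koszul_coprime K0 aG0 hh hm ne)).
have subs r : supported r G -> supported r G0.
  move=> hr t; apply: leq_trans (hr t) _.
  by case: (boolP (_ \in G)) => // /sub[->].
have s0 (H : seq 'X_{1..n}) : supported 0%MM H by move=> t; rewrite mnm0E.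
have [e|[t e]] := H1 m hm.
  have h2 r : supported r G -> excess (m + mu + r)%MM = (excess mu).+1.
    by move=> /subs hr; rewrite [(m + mu)%MM]addmC e H3 // -e.
  have h0 := h2 0%MM (s0 _); rewrite addm0 in h0.
  split; last by rewrite h0 e mdegD mdeg1; lia.
  split=> [g /sub[/H1]|r|] //; first by rewrite h0; apply: h2.
  by rewrite -e => /sub[_]; rewrite eqxx.
(* As [m] itself is not in [G], multiplying by it keeps the product squarefree. *)
have add r : supported r G -> supported (U_(t) + r)%MM G0.
  move=> hr u; rewrite mnmDE mnm1E; have [eu|_] := eqVneq t u; last first.
    by apply: subs.
  have := hr u; rewrite -eu -e hm; case: (boolP (m \in G)) => [/sub[_]|_].
    by rewrite eqxx.
  lia.
have h2 r : supported r G -> excess (m + mu + r)%MM = excess mu.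
  by move=> /add hr; rewrite [(m + mu)%MM]addmC -addmA e H2.
have h0 := h2 0%MM (s0 _); rewrite addm0 in h0.
split; last by rewrite h0 e mdeg1.
split=> [g /sub[/H1]|r|] //; first by rewrite h0; apply: h2.
move=> /sub[hsq _] r /add hr; rewrite h0 -(H3 hsq _ hr); congr excess.
by rewrite e; apply/mnmP=> u; rewrite !mnmDE; lia.
Qed.

Lemma pair_support (i j k l : 'I_n) g : (i <= j)%N -> (k <= l)%N ->
  (l < j)%N || (l == j :> nat) && (k < i)%N ->
  (U_(k) + U_(l) <= g + (U_(i) + U_(j)))%MM ->
  [/\ (k != i :> nat) -> (k != j :> nat) -> (0 < g k)%N,
      (l != i :> nat) -> (l != j :> nat) -> (0 < g l)%N
    & (0 < g k)%N || (0 < g l)%N].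
Proof.
move=> hij hkl hlt /mnm_lepP H.
have := H k; have := H l; rewrite !mnmDE !mnm1E -!val_eqE /= !eqxx.
by split; lia.
Qed.

Lemma pair_coprime (i j k l : 'I_n) : (forall t : 'I_n, (t == k :> nat) || (t == l :> nat) ->
    (t != i :> nat) && (t != j :> nat)) ->
  forall t, (U_(k) + U_(l))%MM t = 0%N \/ (U_(i) + U_(j))%MM t = 0%N.
Proof.
move=> H t; rewrite !mnmDE !mnm1E -!val_eqE /=; have := H t; lia.
Qed.

(** * The colon ideals at the quadrics *)

Section RootChild.
Variables (G0 G : seq 'X_{1..n}) (i j : 'I_n).
Hypotheses (G0q : G0 =i quads a b) (hq : quad_index a b i j).
Hypotheses (GP : child_gens G0 (U_(i) + U_(j))%MM G) (aG : antichain G).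

Let hij : (i <= j)%N. Proof. by case/andP: hq. Qed.

Lemma root_child_variable (s t : 'I_n) g : g \in G ->
  quad_index a b (minn t s) (maxn t s) -> s = i \/ s = j ->
  (maxn t s < j)%N || (maxn t s == j) && (minn t s < i)%N ->
  (0 < g t)%N -> g = U_(t)%MM.
Proof.
move=> hg hts; apply: (child_variable GP aG (erefl _) hij hg).
apply/hasP; exists (U_(t) + U_(s))%MM; last exact: lepm_refl.
rewrite G0q; apply/quadsP; have [le|/ltnW le] := leqP t s.
  by exists t, s; move: hts; rewrite (minn_idPl le) (maxn_idPr le).
by exists s, t; move: hts; rewrite (minn_idPr le) (maxn_idPl le) addmC.
Qed.

Lemma root_child_earlier g : g \in G -> exists k l : 'I_n,
  [/\ quad_index a b k l, (l < j)%N || (l == j :> nat) && (k < i)%N,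
      (U_(k) + U_(l) <= g + (U_(i) + U_(j)))%MM
    & (forall t : 'I_n, (t == k :> nat) || (t == l :> nat) ->
         (t != i :> nat) && (t != j :> nat)) -> g = (U_(k) + U_(l))%MM].
Proof.
move=> hg; have [h [hh hlt hle]] := child_earlier GP hg.
move: (hh); rewrite G0q => /quadsP[k [l [hkl e]]].
exists k, l; split=> //.
- by move: hlt; rewrite e schreyer_lt_pair //; case/andP: hkl.
- by rewrite -e.
- by move=> hco; rewrite -e; apply: (child_coprime GP aG hg hh hlt hle);
    rewrite e; apply: pair_coprime.
Qed.

(** Here and in the next cases, a variable of the earlier quadric that divides [g] is paired with a
    factor of the present one; if this gives another earlier quadric, [g] is that variable. *)
Lemma root_child_xx g : (j < a)%N -> g \in G -> exists2 t : 'I_n, g = U_(t)%MM & (t < a)%N.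
Proof.
move=> hja hg; have [k [l [hkl hlt hle hco]]] := root_child_earlier hg.
have [hk hl hkl0] := pair_support hij (proj1 (andP hkl)) hlt hle.
move: (hq) hkl; rewrite /quad_index => hq' hkl {hle}.
have [gk|gk] := posnP (g k).
  exists l; last by lia.
  by apply: (@root_child_variable i) => //; rewrite /quad_index; [lia|left|lia|lia].
exists k; last by lia.
by apply: (@root_child_variable i) => //; rewrite /quad_index; [lia|left|lia].
Qed.

(** Since [x_i] is interior, [x_1 x_i] is an earlier quadric, so [x_1^2] is absorbed by the variable
    [x_1]. *)
Lemma root_child_xy g : (i < a)%N -> (a < j)%N -> g \in G ->
  exists2 t : 'I_n, g = U_(t)%MM & (t < a + b)%N.
Proof.
move=> hia hja hg; have [k [l [hkl hlt hle hco]]] := root_child_earlier hg.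
have [hk hl hkl0] := pair_support hij (proj1 (andP hkl)) hlt hle.
move: (hq) hkl; rewrite /quad_index => hq' hkl {hle}.
have [la|al] := ltnP l a.
  have [gk|gk] := posnP (g k).
    exists l; last by lia.
    by apply: (@root_child_variable i) => //; rewrite /quad_index; [lia|left|lia|lia].
  exists k; last by lia.
  by apply: (@root_child_variable i) => //; rewrite /quad_index; [lia|left|lia].
have [lj|jl] := ltnP l j.
  exists l; last by lia.
  by apply: (@root_child_variable i) => //; rewrite /quad_index; [lia|left|lia|lia].
exists k; last by lia.
by apply: (@root_child_variable i) => //; rewrite /quad_index; [lia|left|lia|lia].
Qed.

Lemma root_child_square g (k l : 'I_n) :
  g = (U_(k) + U_(l))%MM -> k = 1%N :> nat -> l = 1%N :> nat ->
  g = (U_(x1) + U_(x1))%MM.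
Proof. by move=> -> ek el; congr (U_(_) + U_(_))%MM; apply/val_inj; rewrite /= v1. Qed.

(** Neither [x_1 x_a] nor [x_1 y_j] is a quadric of the list, so [x_1^2] survives. *)
Lemma root_child_xay g : i = a :> nat -> (a < j)%N -> g \in G ->
  g = (U_(x1) + U_(x1))%MM \/
  exists t : 'I_n, [/\ g = U_(t)%MM, t != 1%N :> nat & (t < a + b)%N].
Proof.
move=> hia hja hg; have [k [l [hkl hlt hle hco]]] := root_child_earlier hg.
have [hk hl hkl0] := pair_support hij (proj1 (andP hkl)) hlt hle.
move: (hq) hkl; rewrite /quad_index => hq' hkl {hle}.
have [la|al] := ltnP l a.
  have [l1|l2] := leqP l 1.
    by left; apply: (root_child_square (hco _)) => [t||]; lia.
  right; exists l; split; try by lia.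
  by apply: (@root_child_variable j) => //; rewrite /quad_index; [lia|right|lia|lia].
right; have [lj|jl] := ltnP l j.
  exists l; split; try by lia.
  by apply: (@root_child_variable i) => //; rewrite /quad_index; [lia|left|lia|lia].
exists k; split; try by lia.
by apply: (@root_child_variable j) => //; rewrite /quad_index; [lia|right|lia|lia].
Qed.

(** The smaller factor of the quadric pairs with every [x_k], [2 <= k], but not with [x_1], so
    [x_1^2] survives again. *)
Lemma root_child_yy g : (a.+1 < i)%N -> (i < a + b)%N -> g \in G ->
  g = (U_(x1) + U_(x1))%MM \/
  exists t : 'I_n, [/\ g = U_(t)%MM, t != 1%N :> nat & (t < a + b)%N].
Proof.
move=> hai hib hg; have [k [l [hkl hlt hle hco]]] := root_child_earlier hg.
have [hk hl hkl0] := pair_support hij (proj1 (andP hkl)) hlt hle.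
move: (hq) hkl; rewrite /quad_index => hq' hkl {hle}.
have [la|al] := ltnP l a.
  have [l1|l2] := leqP l 1.
    by left; apply: (root_child_square (hco _)) => [t||]; lia.
  right; exists l; split; try by lia.
  by apply: (@root_child_variable i) => //; rewrite /quad_index; [lia|left|lia|lia].
right; have [ka|ak] := leqP k a.
  exists k; split; try by lia.
  by apply: (@root_child_variable i) => //; rewrite /quad_index; [lia|left|lia|lia].
have [ki|ik] := ltnP k i.
  exists k; split; try by lia.
  by apply: (@root_child_variable j) => //; rewrite /quad_index; [lia|right|lia|lia].
have [gk|gk] := posnP (g k).
  exists l; split; try by lia.
  by apply: (@root_child_variable i) => //; rewrite /quad_index; [lia|left|lia|lia].
exists k; split; try by lia.
by apply: (@root_child_variable i) => //; rewrite /quad_index; [lia|left|lia].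
Qed.

(* The quadrics occurring in the colon ideal at [y_(b-1)^2]. *)
Definition last_quad_index (k l : nat) : bool :=
  (k <= l)%N && ((1 <= k)%N && (l < a)%N || [&& 2 <= k, k <= a & l == a.+1]%N).

(** [y_(b-1)] pairs with the interior [y] only, neither with [y_0] nor with any [x]; quadrics in the
    latter variables are coprime to [y_(b-1)^2] and survive whole. *)
Lemma root_child_last g : i = (a + b)%N :> nat -> g \in G ->
  (exists t : 'I_n, [/\ g = U_(t)%MM, (a.+1 < t)%N & (t < a + b)%N]) \/
  (exists k l : 'I_n, g = (U_(k) + U_(l))%MM /\ last_quad_index k l).
Proof.
move=> hib hg; have [k [l [hkl hlt hle hco]]] := root_child_earlier hg.
have [hk hl hkl0] := pair_support hij (proj1 (andP hkl)) hlt hle.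
move: (hq) (hkl); rewrite /quad_index /last_quad_index => hq' hkl' {hle}.
have [la|al] := leqP l a.+1.
  by right; exists k, l; split; [apply: hco => t|]; lia.
left; have [ka|ak] := leqP k a.
  exists l; split; try by lia.
  by apply: (@root_child_variable j) => //; rewrite /quad_index; [lia|right|lia|lia].
exists k; split; try by lia.
by apply: (@root_child_variable j) => //; rewrite /quad_index; [lia|right|lia|lia].
Qed.

Lemma root_child_last_div (k l : 'I_n) : i = (a + b)%N :> nat -> last_quad_index k l ->
  divisible_by G (U_(k) + U_(l))%MM.
Proof.
move=> hib hkl; apply/GP; exists (U_(k) + U_(l))%MM; split; last exact: lem_addr.
  rewrite G0q; apply/quadsP; exists k, l; split=> //.
  by move: hkl; rewrite /last_quad_index /quad_index; lia.
rewrite schreyer_lt_pair //; last by move: hkl; rewrite /last_quad_index; lia.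
by move: hkl hq; rewrite -val_eqE /= /last_quad_index /quad_index; lia.
Qed.

End RootChild.

Definition last_state mu G : Prop :=
  [/\ mu = (U_(yB) + U_(yB))%MM,
      {in G, forall g,
        (exists t : 'I_n, [/\ g = U_(t)%MM, (a.+1 < t)%N & (t < a + b)%N]) \/
        (exists k l : 'I_n, g = (U_(k) + U_(l))%MM /\ last_quad_index k l)}
    & forall k l : 'I_n, last_quad_index k l -> divisible_by G (U_(k) + U_(l))%MM].

Lemma weight_eq0 (c : 'I_n -> nat) m : (forall t, (0 < c t)%N -> m t = 0%N) -> weight c m = 0%N.
Proof.
by move=> H; rewrite /weight big1 // => t _; have [->|/H->] := posnP (c t); rewrite ?muln0.
Qed.

Lemma supported0 r G t : supported r G -> ~ (U_(t)%MM \in G) -> r t = 0%N.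
Proof. by move=> /(_ t) + /negP/negPf h; rewrite h leqn0 => /eqP. Qed.

(** Reduces a Koszul state without [x_1^2] to the constancy of [excess] on squarefree products of
    the variables in [Q]. *)
Lemma koszul_vars mu G e (Q : 'I_n -> Prop) :
  {in G, forall g, exists2 t, g = U_(t)%MM & Q t} ->
  (forall r, (forall t, ~ Q t -> r t = 0%N) -> (forall t, (r t <= 1)%N) ->
     excess (mu + r)%MM = e) ->
  koszul_state mu G /\ excess mu = e.
Proof.
move=> HG He.
have e0 : excess mu = e by rewrite -(He 0%MM) ?addm0 // => t; rewrite mnm0E.
have Hs r : supported r G -> excess (mu + r)%MM = e.
  move=> hr; apply: He => t; last by apply: leq_trans (hr t) _; case: (_ \in _).
  move=> nQ; apply: (supported0 hr) => /HG[t' /eqP]; rewrite eq_mnm1 => /eqP <- //.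
split=> //; split; rewrite ?e0.
- by move=> g /HG[t -> _]; right; exists t.
- exact: Hs.
- by move=> /HG[t /(congr1 (@mdeg _))]; rewrite mdegD !mdeg1.
Qed.

Lemma koszul_square mu G e (Q : 'I_n -> Prop) :
  {in G, forall g, g = (U_(x1) + U_(x1))%MM \/ exists2 t, g = U_(t)%MM & Q t} ->
  (forall r, (forall t, ~ Q t -> r t = 0%N) ->
     excess (mu + r)%MM = e /\ excess (mu + (U_(x1) + U_(x1)) + r)%MM = e.+1) ->
  koszul_state mu G /\ excess mu = e.
Proof.
move=> HG He.
have [e0 _] := He 0%MM (fun t _ => mnm0E t); rewrite addm0 in e0.
have Hs r : supported r G -> forall t, ~ Q t -> r t = 0%N.
  move=> hr t nQ; apply: (supported0 hr) => /HG[/(congr1 (@mdeg _))|[t' /eqP]].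
    by rewrite mdegD !mdeg1.
  by rewrite eq_mnm1 => /eqP <-.
split=> //; split; rewrite ?e0.
- by move=> g /HG[|[t -> _]]; [left|right; exists t].
- by move=> r /Hs/He[].
- by move=> _ r /Hs/He[].
Qed.

Lemma weight_pair (c : 'I_n -> nat) (i j : 'I_n) r :
  weight c (U_(i) + U_(j) + r)%MM = (c i + c j + weight c r)%N.
Proof. by rewrite !weightD !weight1. Qed.

(** * The state reached at each quadric *)

Section RootState.
Variables (G0 G : seq 'X_{1..n}) (i j : 'I_n).
Hypotheses (G0q : G0 =i quads a b) (hq : quad_index a b i j).
Hypotheses (GP : child_gens G0 (U_(i) + U_(j))%MM G) (aG : antichain G).

(** No [y] divides any of the multidegrees, so [excess] stays zero. *)
Lemma root_state_xx : (j < a)%N ->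
  koszul_state (U_(i) + U_(j))%MM G /\ excess (U_(i) + U_(j))%MM = 0%N.
Proof.
move=> hja; apply: (koszul_vars (Q := fun t => is_true (t < a)%N)).
  by move=> g /(root_child_xx G0q hq GP aG hja).
move=> r Hr _.
have yr : ydeg r = 0%N by apply: weight_eq0 => t; rewrite /isy => ht; apply: Hr; lia.
have rB : r yB = 0%N by apply: Hr; rewrite vB; lia.
have ij : (i <= j)%N by case/andP: hq.
have [iB jB] : (i == (a + b)%N :> nat) = false /\ (j == (a + b)%N :> nat) = false.
  by split; lia.
have [ia ja] : (a < i)%N = false /\ (a < j)%N = false by split; lia.
by rewrite /excess !weight_pair yr /isy !mnmDE !mnm1E -!val_eqE /= v1 va v0 vB rB iB jB
  ia ja andbF.
Qed.

(** As [2 <= i], the variable [x_1] enters only through [r], at most once, and [y_(b-1)] not at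
    all. *)
Lemma root_state_xy : (i < a)%N -> (a < j)%N ->
  koszul_state (U_(i) + U_(j))%MM G /\ excess (U_(i) + U_(j))%MM = 0%N.
Proof.
move=> hia aj; apply: (koszul_vars (Q := fun t => is_true (t < a + b)%N)).
  by move=> g /(root_child_xy G0q hq GP aG hia aj).
move=> r Hr r1.
have rB : r yB = 0%N by apply: Hr; rewrite vB; lia.
have := r1 x1; rewrite /excess !mnmDE !mnm1E -!val_eqE /= v1 va v0 vB rB.
by move: hq; rewrite /quad_index; case: ifP; lia.
Qed.

(** [y_j] divides every multidegree and [y_(b-1)] occurs at most once, so [excess] becomes 1 as soon
    as [x_1^2] enters. *)
Lemma root_state_square : (a <= i)%N -> (a < j)%N -> (i < a + b)%N ->
  koszul_state (U_(i) + U_(j))%MM G /\ excess (U_(i) + U_(j))%MM = 0%N.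
Proof.
move=> hai aj hib.
apply: (koszul_square (Q := fun t => is_true ((t != 1%N :> nat) && (t < a + b)%N))).
  have [ia|ia] := eqVneq (i : nat) a.
    move=> g /(root_child_xay G0q hq GP aG ia aj)[->|[t [-> h1 h2]]]; [by left|right].
    by exists t; rewrite ?h1.
  have ai : (a.+1 < i)%N by move: hq; rewrite /quad_index; lia.
  move=> g /(root_child_yy G0q hq GP aG ai hib)[->|[t [-> h1 h2]]]; [by left|right].
  by exists t; rewrite ?h1.
move=> r Hr.
have rB : r yB = 0%N by apply: Hr; rewrite vB; lia.
have r1 : r x1 = 0%N by apply: Hr; rewrite v1.
have yj : (0 < isy j)%N by rewrite /isy; move: hq; rewrite /quad_index; lia.
have [i1 j1] : (i == 1%N :> nat) = false /\ (j == 1%N :> nat) = false by split; lia.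
have iB : (i == (a + b)%N :> nat) = false by lia.
have B1 : (1%N == a + b)%N = false by lia.
rewrite /excess !weightD !weight1 !mnmDE !mnm1E -!val_eqE /= v1 va v0 vB rB r1 iB i1 j1 B1 eqxx.
by clear - yj; split; case: (_ == _); rewrite /=; lia.
Qed.

Lemma root_state_last : i = (a + b)%N :> nat -> j = (a + b)%N :> nat ->
  last_state (U_(i) + U_(j))%MM G /\ excess (U_(i) + U_(j))%MM = 0%N.
Proof.
move=> ei ej; split.
  split.
  - by rewrite (ord_inj (etrans ei (esym vB))) (ord_inj (etrans ej (esym vB))).
  - by move=> g /(root_child_last G0q hq GP aG ei).
  - by move=> k l /(root_child_last_div G0q hq GP ei).
rewrite /excess !weightD !weight1 /isx !mnmDE !mnm1E -!val_eqE /= v1 va v0 vB ei ej.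
by case: ifP; lia.
Qed.

Lemma root_state :
  (koszul_state (U_(i) + U_(j))%MM G \/ last_state (U_(i) + U_(j))%MM G) /\
  excess (U_(i) + U_(j))%MM = 0%N.
Proof.
have [hja|haj] := ltnP j a; first by have [? ?] := root_state_xx hja; split; [left|].
have aj : (a < j)%N by move: hq; rewrite /quad_index; lia.
have [hia|hai] := ltnP i a; first by have [? ?] := root_state_xy hia aj; split; [left|].
have [hib|hbi] := ltnP i (a + b).
  by have [? ?] := root_state_square hai aj hib; split; [left|].
have [||? ?] := root_state_last; last by split; [right|].
  by move: hq; rewrite /quad_index; lia.
by move: hq; rewrite /quad_index; lia.
Qed.

End RootState.

(** * The colon ideals below [y_(b-1)^2] *)

Section LastChild.
Variables (G0 G : seq 'X_{1..n}) (m : 'X_{1..n}).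
Hypotheses (L0 : last_state (U_(yB) + U_(yB))%MM G0) (aG0 : antichain G0) (hm : m \in G0).
Hypotheses (GP : child_gens G0 m G) (aG : antichain G).

(** Variables precede quadrics in the listing, so only variables [y_s] are met and no [x] divides
    the multidegree. *)
Lemma last_child_linear t : m = U_(t)%MM -> (a.+1 < t)%N -> (t < a + b)%N ->
  koszul_state (m + (U_(yB) + U_(yB)))%MM G /\ excess (m + (U_(yB) + U_(yB)))%MM = 0%N.
Proof.
move=> em h1 h2; have [_ HG0 _] := L0.
apply: (koszul_vars (Q := fun s => is_true ((a.+1 < s)%N && (s < a + b)%N))).
  move=> g hg; have [h [hh hlt hle]] := child_earlier GP hg.
  have [[s [es hs1 hs2]]|[k [l [e _]]]] := HG0 h hh; last first.
    by have := schreyer_lt_mdeg hlt; rewrite e em mdegD !mdeg1.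
  exists s; last by rewrite hs1.
  rewrite -es; apply: (child_coprime GP aG hg hh hlt hle) => u.
  rewrite es em !mnm1E.
  have [e|_] := eqVneq s u; [right|by left].
  have [e'|//] := eqVneq t u.
  by move: hlt; rewrite es em e e' schreyer_lt_irr.
move=> r Hr _.
have ra : r xa = 0%N by apply: Hr; rewrite va; lia.
have xr : xdeg r = 0%N by apply: weight_eq0 => s; rewrite /isx => hs; apply: Hr; lia.
rewrite /excess em !weightD !weight1 xr /isx !mnmDE !mnm1E -!val_eqE /= v1 va v0 vB ra.
by case: ifP; lia.
Qed.

Section Quadric.
Variables i j : 'I_n.
Hypotheses (em : m = (U_(i) + U_(j))%MM) (hq : last_quad_index i j).

Let hij : (i <= j)%N. Proof. by case/andP: hq. Qed.

Lemma last_child_variable (s t : 'I_n) g : g \in G ->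
  last_quad_index (minn t s) (maxn t s) -> s = i \/ s = j ->
  (maxn t s < j)%N || (maxn t s == j) && (minn t s < i)%N ->
  (0 < g t)%N -> g = U_(t)%MM.
Proof.
move=> hg hts; apply: (child_variable GP aG em hij hg); have [_ _ D] := L0.
have [le|/ltnW le] := leqP t s.
  by apply: D; move: hts; rewrite (minn_idPl le) (maxn_idPr le).
by rewrite addmC; apply: D; move: hts; rewrite (minn_idPr le) (maxn_idPl le).
Qed.

Lemma last_child_earlier g : g \in G ->
  (exists t : 'I_n, g = U_(t)%MM /\ (a.+1 < t)%N) \/
  exists k l : 'I_n,
  [/\ last_quad_index k l, (l < j)%N || (l == j :> nat) && (k < i)%N,
      (U_(k) + U_(l) <= g + (U_(i) + U_(j)))%MM
    & (forall t : 'I_n, (t == k :> nat) || (t == l :> nat) ->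
         (t != i :> nat) && (t != j :> nat)) -> g = (U_(k) + U_(l))%MM].
Proof.
move=> hg; have [h [hh hlt hle]] := child_earlier GP hg; have [_ HG0 _] := L0.
have [[s [es hs1 hs2]]|[k [l [e hkl]]]] := HG0 h hh; [left|right].
  exists s; split=> //; rewrite -es; apply: (child_coprime GP aG hg hh hlt hle) => u.
  rewrite es em mnmDE !mnm1E -!val_eqE /=.
  by move: hq; rewrite /last_quad_index; lia.
exists k, l; split=> //.
- by move: hlt; rewrite e em schreyer_lt_pair //; case/andP: hkl.
- by rewrite -e -em.
- by move=> hco; rewrite -e; apply: (child_coprime GP aG hg hh hlt hle);
    rewrite e em; apply: pair_coprime.
Qed.

Lemma last_child_x g : (i < a)%N -> g \in G ->
  exists2 t : 'I_n, g = U_(t)%MM & t != a :> nat.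
Proof.
move=> hia hg; have [[t [-> ht]]|[k [l [hkl hlt hle hco]]]] := last_child_earlier hg.
  by exists t => //; lia.
have [hk hl hkl0] := pair_support hij (proj1 (andP hkl)) hlt hle.
move: (hq) hkl; rewrite /last_quad_index => hq' hkl {hle}.
have [la|al] := ltnP l a.
  have [gk|gk] := posnP (g k).
    exists l; last by lia.
    by apply: (@last_child_variable i) => //; rewrite /last_quad_index; [lia|left|lia|lia].
  exists k; last by lia.
  by apply: (@last_child_variable i) => //; rewrite /last_quad_index; [lia|left|lia].
exists k; last by lia.
by apply: (@last_child_variable j) => //; rewrite /last_quad_index; [lia|right|lia|lia].
Qed.

(** Here [m] is [x_a y_0], no factor of which pairs with [x_1]. *)
Lemma last_child_xa g : i = a :> nat -> g \in G ->
  g = (U_(x1) + U_(x1))%MM \/ exists2 t : 'I_n, g = U_(t)%MM & t != 1%N :> nat.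
Proof.
move=> hia hg; have [[t [-> ht]]|[k [l [hkl hlt hle hco]]]] := last_child_earlier hg.
  by right; exists t => //; lia.
have [hk hl hkl0] := pair_support hij (proj1 (andP hkl)) hlt hle.
move: (hq) hkl; rewrite /last_quad_index => hq' hkl {hle}.
have [la|al] := ltnP l a.
  have [l1|l2] := leqP l 1.
    by left; apply: (root_child_square (hco _)) => [t||]; lia.
  right; exists l; last by lia.
  by apply: (@last_child_variable j) => //; rewrite /last_quad_index; [lia|right|lia|lia].
right; exists k; last by lia.
by apply: (@last_child_variable j) => //; rewrite /last_quad_index; [lia|right|lia|lia].
Qed.

(** The first summand of [excess] accounts for [m] being a quadric; the second becomes 1 only when
    [x_1^2] joins [x_a y_0], since [x_a] occurs in no other case. *)
Lemma last_child_quadric :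
  koszul_state (m + (U_(yB) + U_(yB)))%MM G /\ excess (m + (U_(yB) + U_(yB)))%MM = 1%N.
Proof.
have xi : (0 < isx i)%N by rewrite /isx; move: hq; rewrite /last_quad_index; lia.
have muB r : (1 < (m + (U_(yB) + U_(yB)) + r)%MM yB)%N.
  by rewrite !mnmDE !mnm1E eqxx; clear; lia.
have mux r : (0 < xdeg (m + (U_(yB) + U_(yB)) + r)%MM)%N.
  by rewrite em !weightD !weight1; clear - xi; lia.
have [hia|hai] := ltnP i a.
  apply: (koszul_vars (Q := fun t => is_true (t != a :> nat))).
    by move=> g /(last_child_x hia).
  move=> r Hr _; rewrite /excess muB mux.
  suff -> : (m + (U_(yB) + U_(yB)) + r)%MM xa = 0%N by rewrite andbF.
  rewrite em !mnmDE !mnm1E (Hr xa) ?va ?eqxx // -!val_eqE /= va vB.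
  by move: hq; rewrite /last_quad_index; lia.
have ei : i = a :> nat by move: hq; rewrite /last_quad_index; lia.
have ej : j = a.+1 :> nat by move: hq; rewrite /last_quad_index; lia.
apply: (koszul_square (Q := fun t => is_true (t != 1%N :> nat))).
  by move=> g /(last_child_xa ei).
move=> r Hr; have r1 : r x1 = 0%N by apply: Hr; rewrite v1.
have mu1 : (m + (U_(yB) + U_(yB)) + r)%MM x1 = 0%N.
  by rewrite em !mnmDE !mnm1E -!val_eqE /= v1 vB r1 ei ej; lia.
split; first by rewrite /excess muB mux mu1.
set mu := (_ + _ + _ + _)%MM.
have E : mu = (m + (U_(yB) + U_(yB)) + (U_(x1) + U_(x1) + r))%MM by rewrite /mu -addmA.
have m1 : (1 < mu x1)%N by rewrite /mu !mnmDE !mnm1E eqxx; clear; lia.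
have [ma m0] : (0 < mu xa)%N /\ (0 < mu y0)%N.
  rewrite /mu em (ord_inj (etrans ei (esym va))) (ord_inj (etrans ej (esym v0))).
  by rewrite !mnmDE !mnm1E !eqxx; clear; lia.
by rewrite /excess m1 ma m0 E muB mux.
Qed.

End Quadric.

Lemma last_child : excess (U_(yB) + U_(yB))%MM = 0%N ->
  koszul_state (m + (U_(yB) + U_(yB)))%MM G /\
  (excess (m + (U_(yB) + U_(yB)))%MM).+1 = (mdeg m + excess (U_(yB) + U_(yB))%MM)%N.
Proof.
move=> ->; have [_ HG0 _] := L0.
have [[t [em h1 h2]]|[i [j [em hq]]]] := HG0 m hm.
  by have [? ->] := last_child_linear em h1 h2; split; rewrite // em mdeg1.
by have [? ->] := last_child_quadric em hq; split; rewrite // em mdegD !mdeg1.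
Qed.

End LastChild.

(** * Degrees along the whole resolution *)

Section Resolution.
Variables (gens : nat -> nat -> seq 'X_{1..n}).
Hypothesis HJ : is_mingens (initial_ideal (carpet_ideal a b)) (gens 0%N 0%N).
Hypothesis Hm : forall k i, (i < size (frame gens k.+1))%N ->
  is_mingens (colon_ideal gens k.+1 i) (gens k.+1 i).

(** Both lists generate the same ideal, and the quadrics, having equal degree, cannot properly
    divide one another. *)
Lemma root_gens : gens 0%N 0%N =i quads a b.
Proof.
have [_ anti _] := HJ.
have D m : divisible_by (gens 0%N 0%N) m <-> divisible_by (quads a b) m.
  rewrite -(is_mingens_divisible HJ) (initial_carpetP ha hb).
  split=> [H|H r]; first by apply: H; rewrite msuppX inE.
  by rewrite msuppX inE => /eqP->.
have deg2 q : q \in quads a b -> mdeg q = 2%N.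
  by case/quadsP=> i [j [_ ->]]; rewrite mdegD !mdeg1.
move=> m; apply/idP/idP => hm.
  have /D/hasP[q hq hqm] : divisible_by (gens 0%N 0%N) m.
    by apply/hasP; exists m; rewrite // lepm_refl.
  have /D/hasP[g hg hgq] : divisible_by (quads a b) q.
    by apply/hasP; exists q; rewrite // lepm_refl.
  have e : g = m by apply: anti => //; apply: lepm_trans hgq hqm.
  by rewrite -(@lem_mdeg_eq _ q m) // -e lem_mdeg.
have /D/hasP[g hg hgm] : divisible_by (quads a b) m.
  by apply/hasP; exists m; rewrite // lepm_refl.
have /D/hasP[q hq hqg] : divisible_by (gens 0%N 0%N) g.
  by apply/hasP; exists g; rewrite // lepm_refl.
rewrite -(@lem_mdeg_eq _ g m) // (deg2 m hm) -(deg2 q hq).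
exact: lem_mdeg.
Qed.

(** The homological degree is [k.+1]. Passing to a child with lead monomial [m] adds [mdeg m] to the
    degree and [mdeg m - 1] to [excess], which preserves the equation. *)
Lemma level_state k i : (i < size (frame gens k.+1))%N ->
  let mu := multideg gens k.+1 i in
  [/\ koszul_state mu (gens k.+1 i) \/ last_state mu (gens k.+1 i) /\ excess mu = 0%N,
      antichain (gens k.+1 i) & (k.+2 + excess mu)%N = mdeg mu].
Proof.
have gs := mingens_sorted HJ Hm; have gc := colon_gens_of_mingens Hm.
elim: k i => [|k IH] i hi mu; have GP := child_gens_of_colon gs gc hi;
    have [_ aG _] := Hm hi; have /andP[hj hl] := lead_mem hi.
  have j0 : (lead gens 1 i).2 = 0%N by move: hj; rewrite /=; case: (lead gens 1 i).2.
  rewrite j0 in hl GP; rewrite /mu multidegS j0 -[multideg gens 0 0]/0%MM addm0.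
  have := hl; rewrite root_gens => /quadsP[p [q [hq e]]]; rewrite e in GP *.
  have [[K|L] e0] := root_state root_gens hq GP aG; rewrite e0 mdegD !mdeg1.
    by split=> //; left.
  by split=> //; right.
rewrite /mu multidegS; have [S aG0 Ed] := IH _ hj; rewrite mdegD -Ed.
set mu' := multideg gens k.+1 _ in S Ed *.
suff [K E] : koszul_state ((lead gens k.+2 i).1 + mu')%MM (gens k.+2 i) /\
    (excess ((lead gens k.+2 i).1 + mu')%MM).+1 = (mdeg (lead gens k.+2 i).1 + excess mu')%N.
  by split; [left|exact: aG|lia].
case: S => [K|[L e0]]; first exact: (koszul_child K aG0 hl GP aG).
have [emu _ _] := L; rewrite emu in L e0 *.
exact: (last_child L hl GP aG e0).
Qed.

(** Equal multidegrees would have the same degree and [excess], hence the same homological degree.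
    On [F_0] the multidegree is zero, while on [F_1] the degree is at least 2. *)
Lemma multideg_neq k i j : (i < size (frame gens k.+1))%N -> (j < size (frame gens k))%N ->
  multideg gens k j != multideg gens k.+1 i.
Proof.
move=> hi hj; apply/eqP=> e; have [_ _ E] := level_state hi.
case: k hi hj e E => [|k] hi hj e E; first by move: E; rewrite -e mdeg0.
by have [_ _ E'] := level_state hj; move: E; rewrite -e -E'; lia.
Qed.

End Resolution.

(** Each monomial of an entry is the quotient of two distinct multidegrees, so some variable divides
    it. *)
Lemma carpet_minimal (S : schreyer_data n) :
  is_schreyer_resolution (initial_ideal (carpet_ideal a b)) S -> is_minimal S.
Proof.
move=> [HJ Hm _ Hl _] k i j; rewrite [sdiff S k i j]mpolyE; apply: ideal_gen_sum => m hm.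
have [_ /(_ m hm)[_ E]] := Hl k i j.
have [t mt] : exists t, m t != 0%N.
  apply/existsP; rewrite -negb_forall; apply/negP=> /forallP H.
  have m0 : m = 0%MM by apply/mnmP=> t; rewrite mnm0E; apply/eqP.
  by have /eqP := multideg_neq HJ Hm (ltn_ord i) (ltn_ord j); rewrite -E m0 add0m.
have hle : (U_(t) <= m)%MM by rewrite lep1mP.
rewrite -(submK hle) mpolyXD scalerAl; apply: ideal_gen_mul.
by exists t.
Qed.

End Minimality.

Theorem theorem4p4 (a b : nat) (ha : (2 <= a)%N) (hb : (2 <= b)%N) :
  (exists S : schreyer_data (a.+1 + b.+1),
     is_schreyer_resolution (initial_ideal (carpet_ideal a b)) S) /\
  (forall S : schreyer_data (a.+1 + b.+1),
     is_schreyer_resolution (initial_ideal (carpet_ideal a b)) S ->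
     is_minimal S).
Proof.
split; last by move=> S; apply: carpet_minimal.
apply: (@schreyer_resolution_exists _ _ (mingens (quads a b))).
exact: is_mingens_mingens (initial_carpetP ha hb).
Qed.
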